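(* Fix, before sampling, constants $\bar\delta,\bar\omega,\bar\zeta,\bar\rho,\gamma,R_F,R_y>0$ and a rank profile $\mathbf k=(k_1,\dots,k_q)$ of positive integers, and set $$\epsilon_0:=\bar\delta,\qquad \epsilon_1:=\frac{\bar\omega}2,\qquad \epsilon_2:=\frac{\bar\zeta}2+2\bar\rho\gamma^2 .$$ Given $\bar C_c\in\mathbb S^{n_c}$ and $\sigma_c>0$, draw independently $C_c\sim\operatorname{Unif}\{D\in\mathbb S^{n_c}:\|D-\bar C_c\|_F\le\sigma_c\}$, $c\in[q]$. Let $a_c:=\|\mathcal A_c\|_{F\to2}$, $\mathcal J:=\{c:k_c\le n_c,\ a_c>0\}$, $\delta_c:=\epsilon_1a_c/\gamma$, $\kappa_c:=R_ya_c$, and suppose that for every $c\in\mathcal J$, $$\tau(k_c)>r_c,\qquad 0<\delta_c\le\kappa_c,\qquad \delta_c<\frac{\sigma_c}{4n_c^3}.$$ Let $p_c:=4\mathrm e\,(3\kappa_c/\delta_c)^{r_c}\,(4n_c^3\delta_c/\sigma_c)^{\tau(k_c)}$. Suppose the sampled costs $C_c$ are used throughout the run, and that the terminal output $(F,y,\rho)$ at profile $\mathbf k$ (which may depend on the sampled costs), with $\rho>0$, satisfies $$\|c(F)\|_2\le\bar\delta,\quad \|\nabla\Phi_{\rho,y}(F)\|_\oplus\le\bar\omega,\quad \lambda_{\min}\bigl(\nabla^2\Phi_{\rho,y}(F)\bigr)\ge-\bar\zeta,\quad \rho\le\bar\rho,$$ and, with $\widehat y=y-\rho c(F)$, $\|F\|_\oplus\le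 R_F$ and $\|\widehat y\|_2\le R_y$. Write $X_c:=F_cF_c^\top$ and $\sigma_{\max}:=\max_c\sigma_c$. Then, with probability at least $1-\sum_{c\in\mathcal J}p_c$, the following hold. (i) For the sampled costs, $X_c\succeq0$ for all $c$, $\|\sum_c\mathcal A_c(X_c)-b\|_2\le\epsilon_0$, $\bigl(\sum_c\|S_c(\widehat y)X_c\|_F^2\bigr)^{1/2}\le R_F\epsilon_1$, and $S_c(\widehat y)\succeq-\epsilon_2I_{n_c}$ for all $c\in[q]$. (ii) For the nominal costs $(\bar C_c)_c$, the same output $((X_c)_c,\widehat y)$ is approximately optimal with tolerances $$\bigl(\epsilon_0,\ R_F\epsilon_1+\sigma_{\max}R_F^2,\ \epsilon_2+\sigma_{\max}\bigr).$$ (iii) If $\tau_{\mathrm{dual}}\ge\epsilon_2$, then on the same event no block $c\in[q]$ admits a unit vector $v$ with $v^\top S_c(\widehat y)v<-\tau_{\mathrm{dual}}$ (sampled slack).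
   Context: Let $q,m,n_1,\dots,n_q$ be positive integers, $[q]=\{1,\dots,q\}$, $\mathbb S^n$ the real symmetric $n\times n$ matrices. Fix $b\in\mathbb R^m$ and linear maps $\mathcal A_c:\mathbb S^{n_c}\to\mathbb R^m$ with adjoints $\mathcal A_c^*$. The $m$ affine constraints $\sum_c\mathcal A_c(X_c)=b$ are given in a linearly independent representation, i.e. $(H_c)_c\mapsto\sum_c\mathcal A_c(H_c)$ has rank $m$. Let $r_c:=\operatorname{rank}(\mathcal A_c)$, $\tau(k):=k(k+1)/2$, $\|\mathcal A_c\|_{F\to2}$ the operator norm from Frobenius to Euclidean norm, and $\mathrm e$ Euler's number. Factors: $F=(F_c)_c$, $F_c\in\mathbb R^{n_c\times k_c}$, $\|F\|_\oplus^2:=\sum_c\|F_c\|_F^2$; $c(F):=\sum_c\mathcal A_c(F_cF_c^\top)-b$. With the sampled costs, $S_c(\lambda):=C_c-\mathcal A_c^*(\lambda)$ and $\Phi_{\rho,y}(F):=\sum_c\langle C_c,F_cF_c^\top\rangle-\langle y,c(F)\rangle+\frac\rho2\|c(F)\|_2^2$; gradient, Hessian and its minimum eigenvalue are taken over the full Euclidean direct-sum factor space. For costs $(D_c)_c$, a pair $((X_c)_c,\lambda)$ is $(\varepsilon_0,\varepsilon_1,\varepsilon_2)$-approximately optimal if $X_c\succeq0$ for all $c$, $\|\sum_c\mathcal A_c(X_c)-b\|_2\le\varepsilon_0$, $\bigl(\sum_c\|(D_c-\mathcal A_c^*(\lambda))X_c\|_F^2\bigr)^{1/2}\le\varepsilon_1$,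 and $D_c-\mathcal A_c^*(\lambda)\succeq-\varepsilon_2I_{n_c}$ for all $c$. *)

(* Defs.v *)
From HB Require Import structures.
From mathcomp Require Export all_boot all_order all_algebra.
From mathcomp Require Export all_classical all_reals all_analysis.

Set Implicit Arguments.
Unset Strict Implicit.
Unset Printing Implicit Defensive.

Import Order.TTheory GRing.Theory Num.Theory.
Import numFieldNormedType.Exports.

Local Open Scope classical_set_scope.
Local Open Scope ring_scope.

(* Frobenius inner product; on column vectors, the Euclidean one. *)
Definition mxdot (R : realType) (p r : nat) (M N : 'M[R]_(p, r)) : R :=
  \sum_i \sum_j M i j * N i j.

Definition mxnorm2 (R : realType) (p r : nat) (M : 'M[R]_(p, r)) : R :=
  Num.sqrt (mxdot M M).

(* The space of symmetric matrices, as the fixed space of transposition; being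
   a vectType, it gives access to 'Hom and \dim for the constraint maps. *)
Definition symv (R : realType) (n : nat) : {vspace 'M[R]_n} :=
  fixedSpace (linfun (@trmx R n n)).

Notation symmx R n := (subvs_of (symv R n)).

Lemma symvP (R : realType) (n : nat) (M : 'M[R]_n) :
  reflect (M^T = M) (M \in symv R n).
Proof.
by apply: (iffP idP) => [/fixedSpaceP|e]; [|apply/fixedSpaceP]; rewrite lfunE.
Qed.

Lemma sympart_subproof (R : realType) (n : nat) (M : 'M[R]_n) :
  2^-1 *: (M + M^T) \in symv R n.
Proof. by apply/symvP; rewrite linearZ linearD /= trmxK addrC. Qed.

Definition sympart (R : realType) (n : nat) (M : 'M[R]_n) : symmx R n :=
  Subvs (sympart_subproof M).

Lemma gram_subproof (R : realType) (n k : nat) (F : 'M[R]_(n, k)) :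
  F *m F^T \in symv R n.
Proof. by apply/symvP; rewrite trmx_mul trmxK. Qed.

Definition gram (R : realType) (n k : nat) (F : 'M[R]_(n, k)) : symmx R n :=
  Subvs (gram_subproof F).

Definition psd (R : realType) (n : nat) (M : 'M[R]_n) : Prop :=
  M^T = M /\ forall v : 'cV[R]_n, 0 <= (v^T *m M *m v) 0 0.

Definition loewner_ge (R : realType) (n : nat) (M N : 'M[R]_n) : Prop :=
  psd (M - N).

Definition tau (k : nat) : nat := (k * k.+1)./2.

Definition maprank (R : realType) (n m : nat)
    (A : 'Hom(symmx R n, 'cV[R]_m)) : nat := \dim (limg A).

Definition opnormF2 (R : realType) (n m : nat)
    (A : 'Hom(symmx R n, 'cV[R]_m)) : R :=
  sup [set mxnorm2 (A X) | X in [set X : symmx R n | mxnorm2 (val X) <= 1]].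

(* See adjmapP for the defining property. *)
Definition adjmap (R : realType) (n m : nat)
    (A : 'Hom(symmx R n, 'cV[R]_m)) (l : 'cV[R]_m) : symmx R n :=
  sympart (\matrix_(i, j) mxdot l (A (sympart (delta_mx i j)))).

(* The range of (H_c)_c |-> \sum_c A_c(H_c), see total_rangeP. *)
Definition total_range (R : realType) (q m : nat) (n : 'I_q -> nat)
    (A : forall c, 'Hom(symmx R (n c), 'cV[R]_m)) : {vspace 'cV[R]_m} :=
  (\sum_c limg (A c))%VS.

Lemma total_rangeP (R : realType) (q m : nat) (n : 'I_q -> nat)
    (A : forall c, 'Hom(symmx R (n c), 'cV[R]_m)) (v : 'cV[R]_m) :
  v \in total_range A <->
  exists H : forall c, symmx R (n c), v = \sum_c A c (H c).
Proof.
split=> [/memv_sumP[vs hvs ->]|[H ->]]; last first.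
  by apply: memv_sumr => c _; apply: memv_img; rewrite memvf.
have h c : {H : symmx R (n c) | vs c = A c H}.
  by apply: cid; have /memv_imgP[H _ e] := hvs c isT; exists H.
by exists (fun c => sval (h c)); apply: eq_bigr => c _; apply: (svalP (h c)).
Qed.

Lemma half_double (R : realType) (n : nat) (M : 'M[R]_n) : 2^-1 *: (M + M) = M.
Proof.
rewrite scalerDr -scalerDl -[RHS]scale1r; congr (_ *: _).
by rewrite [RHS]splitr mul1r.
Qed.

Lemma mxdot_is_linear (R : realType) (p r : nat) (M : 'M[R]_(p, r)) :
  linear_for *%R (mxdot M).
Proof.
move=> a N1 N2; rewrite /mxdot mulr_sumr -big_split; apply: eq_bigr => i _ /=.
rewrite mulr_sumr -big_split; apply: eq_bigr => j _ /=.
by rewrite !mxE mulrDr mulrCA.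
Qed.

HB.instance Definition _ (R : realType) (p r : nat) (M : 'M[R]_(p, r)) :=
  GRing.isLinear.Build R 'M[R]_(p, r) R _ (mxdot M) (mxdot_is_linear M).

Lemma sympart_is_linear (R : realType) (n : nat) : linear (@sympart R n).
Proof.
move=> a M N; apply: val_inj => /=.
have -> : (a *: M + N)^T = a *: M^T + N^T by rewrite linearD linearZ.
by rewrite addrACA -scalerDr [LHS]scalerDr !scalerA mulrC.
Qed.

HB.instance Definition _ (R : realType) (n : nat) :=
  GRing.isLinear.Build R 'M[R]_n (symmx R n) _ (@sympart R n)
    (@sympart_is_linear R n).

Lemma sympartK (R : realType) (n : nat) (X : symmx R n) : sympart (val X) = X.
Proof.
by apply: val_inj => /=; rewrite (symvP _ (subvsP X)) half_double.
Qed.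

Lemma adjmapP (R : realType) (n m : nat) (A : 'Hom(symmx R n, 'cV[R]_m))
    (X : symmx R n) (l : 'cV[R]_m) :
  mxdot l (A X) = mxdot (val (adjmap A l)) (val X).
Proof.
pose G := \matrix_(i, j) mxdot l (A (sympart (delta_mx i j))).
have GT : G^T = G.
  apply/matrixP => i j; rewrite !mxE; congr (mxdot l (A _)).
  by apply: val_inj; rewrite /= !trmx_delta addrC.
rewrite /adjmap /= -/G GT half_double -{1}[X]sympartK.
rewrite {1}[val X]matrix_sum_delta !linear_sum; apply: eq_bigr => i _ /=.
rewrite !linear_sum; apply: eq_bigr => j _.
by rewrite !linearZ /= mxE mulrC.
Qed.

(* Orthonormal coordinates of the Euclidean space of symmetric matrices: one per
   pair i <= j, the off-diagonal ones being scaled by sqrt 2. *)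
Definition uppair (n : nat) : finType := {p : 'I_n * 'I_n | (p.1 <= p.2)%N}.

Definition svec (R : realType) (n : nat) (X : symmx R n) :
    #|uppair n|.-tuple R :=
  [tuple (let p := val (enum_val t) in
          (if p.1 == p.2 then 1 else Num.sqrt 2) * (val X) p.1 p.2)
  | t < #|uppair n|].

(* Lebesgue measure of a Borel subset of R^d, as an iterated integral. *)
Fixpoint lebesgue_tuple (R : realType) (d : nat) : set (d.-tuple R) -> \bar R :=
  match d with
  | 0 => fun B => \d_ [tuple] B
  | d'.+1 => fun B => (\int[lebesgue_measure]_(x in setT)
      lebesgue_tuple [set t : d'.-tuple R | B [tuple of x :: t]])%E
  end.

Lemma lebesgue_tuple0 (R : realType) (d : nat) :
  lebesgue_tuple (set0 : set (d.-tuple R)) = 0%E.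
Proof.
by elim: d => [|d IH] /=; [rewrite diracE in_set0|rewrite integral0_eq].
Qed.

Lemma lebesgue_tuple_box (R : realType) (d : nat) (B : 'I_d -> set R) :
  (forall i, measurable (B i)) ->
  lebesgue_tuple [set t : d.-tuple R | forall i, B i (tnth t i)] =
  (\prod_(i < d) lebesgue_measure (B i))%E.
Proof.
elim: d B => [|d IH] B mB.
  rewrite big_ord0 /= diracE mem_set //; by case.
rewrite big_ord_recl /= -(IH (fun i => B (lift ord0 i))) //.
set v := lebesgue_tuple _.
transitivity (\int[lebesgue_measure]_(x in B ord0) v)%E; last first.
  by rewrite integral_cst; [rewrite -/v; exact: muleC|exact: mB].
rewrite [RHS]integral_mkcond; apply: eq_integral => x _.
rewrite patchE; case: ifPn => [/set_mem Bx|/negP nBx].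
  congr lebesgue_tuple; apply/seteqP; split => t /= h i.
    by have := h (lift ord0 i); rewrite tnthS.
  by case: (unliftP ord0 i) => [j ->|->]; rewrite ?tnthS ?tnth0.
rewrite -[RHS](lebesgue_tuple0 R d); congr lebesgue_tuple.
apply/seteqP; split => t //= h; apply: nBx.
by apply/mem_set; have := h ord0; rewrite tnth0.
Qed.

Definition frob_ball (R : realType) (n : nat) (Cbar : symmx R n) (s : R) :
    set (symmx R n) :=
  [set D | mxnorm2 (val D - val Cbar) <= s].

(* X is a random symmetric matrix (events and laws are expressed in the
   coordinates svec) and its law is normalized Lebesgue measure on the ball. *)
Definition uniform_frob_ball (R : realType) (d : measure_display)
    (T : measurableType d) (P : probability T R) (n : nat)
    (X : T -> symmx R n) (Cbar : symmx R n) (s : R) : Prop :=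
  let K := @svec R n @` frob_ball Cbar s in
  measurable_fun setT (fun w => svec (X w)) /\
  forall B : set (#|uppair n|.-tuple R), measurable B ->
    P [set w | B (svec (X w))] =
    (lebesgue_tuple (B `&` K) * ((fine (lebesgue_tuple K))^-1)%:E)%E.

Definition mutually_independent (R : realType) (d : measure_display)
    (T : measurableType d) (P : probability T R) (q : nat) (n : 'I_q -> nat)
    (X : forall c, T -> symmx R (n c)) : Prop :=
  forall (J : {set 'I_q}) (B : forall c, set (#|uppair (n c)|.-tuple R)),
    (forall c, measurable (B c)) ->
    P [set w | forall c, c \in J -> B c (svec (X c w))] =
    (\prod_(c in J) P [set w | B c (svec (X c w))])%E.

Definition factors (R : realType) (q : nat) (n k : 'I_q -> nat) : Type :=
  forall c, 'M[R]_(n c, k c).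

Definition oplus_norm (R : realType) (q : nat) (n k : 'I_q -> nat)
    (F : factors R n k) : R :=
  Num.sqrt (\sum_c mxnorm2 (F c) ^+ 2).

(* The direct-sum factor space in its standard orthonormal coordinates. *)
Definition flatten_factors (R : realType) (q : nat) (n k : 'I_q -> nat)
    (F : factors R n k) : 'rV[R]_(\sum_c n c * k c) :=
  \mxrow_c mxvec (F c).

Definition unflatten_factors (R : realType) (q : nat) (n k : 'I_q -> nat)
    (x : 'rV[R]_(\sum_c n c * k c)) : factors R n k :=
  fun c => vec_mx (submxrow x c).

Lemma flatten_factorsK (R : realType) (q : nat) (n k : 'I_q -> nat)
    (F : factors R n k) c :
  unflatten_factors (flatten_factors F) c = F c.
Proof. by rewrite /unflatten_factors /flatten_factors mxrowK mxvecK. Qed.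

Definition partial (R : realType) (N : nat) (f : 'rV[R]_N -> R) (i : 'I_N) :
    'rV[R]_N -> R :=
  fun x => 'D_(delta_mx 0 i) f x.

Definition gradient (R : realType) (N : nat) (f : 'rV[R]_N -> R)
    (x : 'rV[R]_N) : 'rV[R]_N :=
  \row_i partial f i x.

Definition hessian (R : realType) (N : nat) (f : 'rV[R]_N -> R)
    (x : 'rV[R]_N) : 'M[R]_N :=
  \matrix_(i, j) partial (partial f j) i x.

(* The minimum eigenvalue of a symmetric matrix of positive size, whose set of
   eigenvalues is finite and nonempty. *)
Definition lambda_min (R : realType) (N : nat) (M : 'M[R]_N) : R :=
  inf [set a | eigenvalue M a].

Definition constr (R : realType) (q m : nat) (n k : 'I_q -> nat)
    (A : forall c, 'Hom(symmx R (n c), 'cV[R]_m)) (b : 'cV[R]_m)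
    (F : factors R n k) : 'cV[R]_m :=
  \sum_c A c (gram (F c)) - b.

Definition Phi (R : realType) (q m : nat) (n k : 'I_q -> nat)
    (A : forall c, 'Hom(symmx R (n c), 'cV[R]_m)) (b : 'cV[R]_m)
    (C : forall c, symmx R (n c)) (rho : R) (y : 'cV[R]_m)
    (F : factors R n k) : R :=
  \sum_c mxdot (val (C c)) (F c *m (F c)^T) - mxdot y (constr A b F)
  + rho / 2 * mxnorm2 (constr A b F) ^+ 2.

Definition grad_Phi (R : realType) (q m : nat) (n k : 'I_q -> nat)
    (A : forall c, 'Hom(symmx R (n c), 'cV[R]_m)) (b : 'cV[R]_m)
    (C : forall c, symmx R (n c)) (rho : R) (y : 'cV[R]_m)
    (F : factors R n k) : factors R n k :=
  unflatten_factors
    (gradient (fun x => Phi A b C rho y (unflatten_factors x))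
              (flatten_factors F)).

Definition hess_Phi (R : realType) (q m : nat) (n k : 'I_q -> nat)
    (A : forall c, 'Hom(symmx R (n c), 'cV[R]_m)) (b : 'cV[R]_m)
    (C : forall c, symmx R (n c)) (rho : R) (y : 'cV[R]_m)
    (F : factors R n k) : 'M[R]_(\sum_c n c * k c) :=
  hessian (fun x => Phi A b C rho y (unflatten_factors x))
          (flatten_factors F).

Definition slack (R : realType) (n m : nat) (A : 'Hom(symmx R n, 'cV[R]_m))
    (D : symmx R n) (l : 'cV[R]_m) : 'M[R]_n :=
  val D - val (adjmap A l).

Definition approx_optimal (R : realType) (q m : nat) (n : 'I_q -> nat)
    (A : forall c, 'Hom(symmx R (n c), 'cV[R]_m)) (b : 'cV[R]_m)
    (D : forall c, symmx R (n c)) (e0 e1 e2 : R)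
    (X : forall c, symmx R (n c)) (l : 'cV[R]_m) : Prop :=
  [/\ forall c, psd (val (X c)),
      mxnorm2 (\sum_c A c (X c) - b) <= e0,
      Num.sqrt (\sum_c mxnorm2 (slack (A c) (D c) l *m val (X c)) ^+ 2) <= e1 &
      forall c, loewner_ge (slack (A c) (D c) l) (- e2)%:M].

(* Main.v *)
From HB Require Import structures.
Require Import Defs.
From mathcomp Require Import all_boot all_order all_algebra.
From mathcomp Require Import all_classical all_reals all_analysis.
From mathcomp Require Import measurable_realfun ring lra.

Set Implicit Arguments.
Unset Strict Implicit.
Unset Printing Implicit Defensive.

Import Order.TTheory GRing.Theory Num.Theory.
Import numFieldNormedType.Exports.

Local Open Scope classical_set_scope.
Local Open Scope ring_scope.

(** Write S_c for the slack of block c at the shifted multiplier yhat. The gradient of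
the augmented Lagrangian in block c is 2 S_c F_c, so approximate stationarity makes
S_c F_c small and hence S_c X_c, because X_c = F_c F_c^T. The Hessian in the direction
u v^T of block c is twice the form of S_c at u plus a penalty that is quadratic in
|F_c v|. So the lower bound on the smallest eigenvalue of the Hessian passes to S_c as
soon as some unit vector v satisfies a_c |F_c v| <= gam ([block_curvature],
[sampled_certificate]). Such a v exists trivially when k_c > n_c or a_c = 0. The
nominal costs differ from the sampled ones by at most sigma_c almost surely
([nominal_certificate]).

The probabilistic part shows that in a block of J such a v is missing with probability
at most p_c. If it is missing, F_c is bounded below by gam / a_c on unit vectors, and
therefore S_c almost annihilates the k_c-dimensional range of F_c, up to the factor
delta_c. Since S_c is the sampled cost minus a point of a ball of radius kappa_c in the
r_c-dimensional range of the adjoint map, a delta_c-net of that ball ([adjmap_net])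
reduces the claim to finitely many fixed matrices Z, and to the volume of the symmetric
matrices M in the ball for which M - Z almost annihilates a space of dimension k.

That volume is estimated without any spectral theory. Normalize a basis of the space by
its largest minor ([maximal_minor_basis]): its rows f form the identity and all its
entries are at most 1 in absolute value. Two such matrices M and M' that agree outside
the block of rows and columns f have close f blocks ([block_rigidity]). So the set has
fibers of side O(n delta) in the tau(k) coordinates of that block, and a set with thin
fibers fills a small part of the ball ([thin_fibers_ratio], [near_kernel_measure]).
Summing over the n^k choices of f and over the net gives the bound ([bad_block]). The
estimate holds block by block, and a union bound over J concludes. *)

(** * Frobenius inner product and norm *)

Lemma mxdotE (R : realType) (p r : nat) (M N : 'M[R]_(p, r)) :
  mxdot M N = \tr (M^T *m N).
Proof.
rewrite /mxdot /mxtrace exchange_big; apply: eq_bigr => j _ /=.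
by rewrite mxE; apply: eq_bigr => i _; rewrite mxE.
Qed.

Lemma mxdotC (R : realType) (p r : nat) (M N : 'M[R]_(p, r)) :
  mxdot M N = mxdot N M.
Proof. by apply: eq_bigr => i _; apply: eq_bigr => j _; rewrite mulrC. Qed.

Lemma mxdotDr (R : realType) (p r : nat) (M N P : 'M[R]_(p, r)) :
  mxdot M (N + P) = mxdot M N + mxdot M P.
Proof. exact: linearD. Qed.

Lemma mxdotZr (R : realType) (p r : nat) (a : R) (M N : 'M[R]_(p, r)) :
  mxdot M (a *: N) = a * mxdot M N.
Proof. exact: linearZ. Qed.

Lemma mxdotDl (R : realType) (p r : nat) (M N P : 'M[R]_(p, r)) :
  mxdot (M + N) P = mxdot M P + mxdot N P.
Proof. by rewrite mxdotC mxdotDr !(mxdotC P). Qed.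

Lemma mxdotZl (R : realType) (p r : nat) (a : R) (M N : 'M[R]_(p, r)) :
  mxdot (a *: M) N = a * mxdot M N.
Proof. by rewrite mxdotC mxdotZr mxdotC. Qed.

Lemma mxdotNl (R : realType) (p r : nat) (M N : 'M[R]_(p, r)) :
  mxdot (- M) N = - mxdot M N.
Proof. by rewrite -scaleN1r mxdotZl mulN1r. Qed.

Lemma mxdotNr (R : realType) (p r : nat) (M N : 'M[R]_(p, r)) :
  mxdot M (- N) = - mxdot M N.
Proof. exact: linearN. Qed.

Lemma mxdot_tr (R : realType) (p r : nat) (M N : 'M[R]_(p, r)) :
  mxdot M^T N^T = mxdot M N.
Proof.
rewrite /mxdot exchange_big; apply: eq_bigr => i _; apply: eq_bigr => j _.
by rewrite !mxE.
Qed.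

Lemma mxdot_mull (R : realType) (p q r : nat) (M : 'M[R]_(p, q))
    (N : 'M[R]_(q, r)) (Q : 'M[R]_(p, r)) :
  mxdot (M *m N) Q = mxdot N (M^T *m Q).
Proof. by rewrite !mxdotE trmx_mul mulmxA. Qed.

Lemma mxdot_mulr (R : realType) (p q r : nat) (M : 'M[R]_(p, q))
    (N : 'M[R]_(q, r)) (Q : 'M[R]_(p, r)) :
  mxdot (M *m N) Q = mxdot M (Q *m N^T).
Proof. by rewrite -mxdot_tr trmx_mul mxdot_mull -mxdot_tr trmx_mul !trmxK. Qed.

Lemma mxdot_ge0 (R : realType) (p r : nat) (M : 'M[R]_(p, r)) : 0 <= mxdot M M.
Proof.
by apply: sumr_ge0 => i _; apply: sumr_ge0 => j _; rewrite -expr2 sqr_ge0.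
Qed.

Lemma mxnorm2_ge0 (R : realType) (p r : nat) (M : 'M[R]_(p, r)) :
  0 <= mxnorm2 M.
Proof. exact: sqrtr_ge0. Qed.

Lemma sqr_mxnorm2 (R : realType) (p r : nat) (M : 'M[R]_(p, r)) :
  mxnorm2 M ^+ 2 = mxdot M M.
Proof. by rewrite sqr_sqrtr ?mxdot_ge0. Qed.

Lemma mxnorm2_le (R : realType) (p r : nat) (M : 'M[R]_(p, r)) (s : R) :
  0 <= s -> (mxnorm2 M <= s) = (mxdot M M <= s ^+ 2).
Proof.
by move=> s0; rewrite -sqr_mxnorm2 ler_sqr // nnegrE ?mxnorm2_ge0.
Qed.

Lemma mxnorm2_eq0 (R : realType) (p r : nat) (M : 'M[R]_(p, r)) :
  mxnorm2 M = 0 -> M = 0.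
Proof.
move=> M0; have : mxdot M M = 0 by rewrite -sqr_mxnorm2 M0 expr0n.
move/eqP; rewrite psumr_eq0 => [/allP h|i _]; last first.
  by apply: sumr_ge0 => j _; rewrite -expr2 sqr_ge0.
apply/matrixP => i j; rewrite mxE.
have := h i (mem_index_enum i); rewrite psumr_eq0 => [/allP h2|j' _]; last first.
  by rewrite -expr2 sqr_ge0.
by have := h2 j (mem_index_enum j); rewrite -expr2 sqrf_eq0 => /eqP.
Qed.

Lemma mxnorm20 (R : realType) (p r : nat) : mxnorm2 (0 : 'M[R]_(p, r)) = 0.
Proof.
by rewrite /mxnorm2 linear0 sqrtr0.
Qed.

Lemma mxnorm2_gt0 (R : realType) (p r : nat) (M : 'M[R]_(p, r)) :
  M != 0 -> 0 < mxnorm2 M.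
Proof.
move=> M0; rewrite lt_neqAle mxnorm2_ge0 andbT eq_sym.
by apply: contraNneq M0 => /mxnorm2_eq0 ->.
Qed.

Lemma mxnorm2Z (R : realType) (p r : nat) (a : R) (M : 'M[R]_(p, r)) :
  mxnorm2 (a *: M) = `|a| * mxnorm2 M.
Proof.
by rewrite /mxnorm2 mxdotZl mxdotZr mulrA -expr2 sqrtrM ?sqr_ge0 // sqrtr_sqr.
Qed.

Lemma mxnorm2N (R : realType) (p r : nat) (M : 'M[R]_(p, r)) :
  mxnorm2 (- M) = mxnorm2 M.
Proof. by rewrite -scaleN1r mxnorm2Z normrN1 mul1r. Qed.

Lemma mxnorm2_tr (R : realType) (p r : nat) (M : 'M[R]_(p, r)) :
  mxnorm2 M^T = mxnorm2 M.
Proof. by rewrite /mxnorm2 mxdot_tr. Qed.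

Lemma mxdot_cauchy (R : realType) (p r : nat) (M N : 'M[R]_(p, r)) :
  mxdot M N <= mxnorm2 M * mxnorm2 N.
Proof.
have [->|M0] := eqVneq M 0; first by rewrite mxdotC linear0 mxnorm20 mul0r.
have [->|N0] := eqVneq N 0; first by rewrite linear0 mxnorm20 mulr0.
have m0 := mxnorm2_gt0 M0; have n0 := mxnorm2_gt0 N0.
have := mxdot_ge0 (mxnorm2 N *: M - mxnorm2 M *: N).
rewrite mxdotDl !mxdotDr !mxdotNl !mxdotNr !mxdotZl !mxdotZr -!sqr_mxnorm2.
rewrite (mxdotC N M); set a := mxnorm2 M in m0 *; set b := mxnorm2 N in n0 *.
set c := mxdot M N => h.
have : 0 <= (2 * (a * b)) * (a * b - c).
  by apply: le_trans h _; rewrite le_eqVlt; apply/orP; left; apply/eqP; ring.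
by rewrite pmulr_rge0 ?subr_ge0 // mulr_gt0 // mulr_gt0.
Qed.

Lemma mxdot_cauchy_abs (R : realType) (p r : nat) (M N : 'M[R]_(p, r)) :
  `|mxdot M N| <= mxnorm2 M * mxnorm2 N.
Proof.
rewrite ler_norml mxdot_cauchy andbT lerNl -mxdotNl -(mxnorm2N M).
exact: mxdot_cauchy.
Qed.

Lemma mxnorm2D (R : realType) (p r : nat) (M N : 'M[R]_(p, r)) :
  mxnorm2 (M + N) <= mxnorm2 M + mxnorm2 N.
Proof.
rewrite mxnorm2_le ?addr_ge0 ?mxnorm2_ge0 // mxdotDl !mxdotDr (mxdotC N M).
have := mxdot_cauchy M N; rewrite sqrrD !sqr_mxnorm2; lra.
Qed.

Lemma mxnorm2_coef (R : realType) (p r : nat) (M : 'M[R]_(p, r)) i j :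
  `|M i j| <= mxnorm2 M.
Proof.
rewrite -(ler_sqr (normr_ge0 _) (mxnorm2_ge0 _)) sqr_mxnorm2 real_normK ?num_real //.
rewrite /mxdot (bigD1 i) //= (bigD1 j) //= -expr2 -addrA lerDl addr_ge0 //.
  by apply: sumr_ge0 => j' _; rewrite -expr2 sqr_ge0.
by apply: sumr_ge0 => i' _; apply: sumr_ge0 => j' _; rewrite -expr2 sqr_ge0.
Qed.

Lemma mxdot_col (R : realType) (p r : nat) (M N : 'M[R]_(p, r)) :
  mxdot M N = \sum_j mxdot (col j M) (col j N).
Proof.
rewrite /mxdot exchange_big /=; apply: eq_bigr => j _; apply: eq_bigr => i _.
by rewrite big_ord1 !mxE.
Qed.

Lemma mxnorm2_mulv (R : realType) (p q : nat) (M : 'M[R]_(p, q)) (v : 'cV[R]_q) :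
  mxnorm2 (M *m v) <= mxnorm2 M * mxnorm2 v.
Proof.
rewrite mxnorm2_le ?mulr_ge0 ?mxnorm2_ge0 // exprMn !sqr_mxnorm2.
rewrite {1 2}/mxdot mulr_suml; apply: ler_sum => i _.
have rE : (M *m v) i 0 = mxdot (row i M)^T v.
  by rewrite mxE /mxdot; apply: eq_bigr => j _; rewrite big_ord1 !mxE.
rewrite big_ord1 rE -expr2.
have -> : \sum_j M i j * M i j = mxdot (row i M)^T (row i M)^T.
  by rewrite /mxdot; apply: eq_bigr => j _; rewrite big_ord1 !mxE.
rewrite -!sqr_mxnorm2 -exprMn -real_normK ?num_real //.
rewrite ler_sqr ?nnegrE ?mulr_ge0 ?mxnorm2_ge0 //.
exact: mxdot_cauchy_abs.
Qed.

Lemma mxnorm2_mul (R : realType) (p q r : nat) (M : 'M[R]_(p, q))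
    (N : 'M[R]_(q, r)) :
  mxnorm2 (M *m N) <= mxnorm2 M * mxnorm2 N.
Proof.
rewrite mxnorm2_le ?mulr_ge0 ?mxnorm2_ge0 // exprMn !sqr_mxnorm2.
rewrite (mxdot_col (M *m N)) (mxdot_col N) mulr_sumr; apply: ler_sum => j _.
rewrite -!sqr_mxnorm2 -exprMn ler_sqr ?nnegrE ?mulr_ge0 ?mxnorm2_ge0 //.
by rewrite colE -mulmxA -colE mxnorm2_mulv.
Qed.

Lemma quad_mxdot (R : realType) (n : nat) (M : 'M[R]_n) (v : 'cV[R]_n) :
  (v^T *m M *m v) 0 0 = mxdot v (M *m v).
Proof.
rewrite mxdotE -mulmxA; rewrite /mxtrace big_ord1 //.
Qed.

(** * Lebesgue measure on tuples *)

Definition box (R : realType) (d : nat) (B : 'I_d -> set R) : set (d.-tuple R) :=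
  [set t | forall i, B i (tnth t i)].

Lemma measurable_tnthR (R : realType) (d : nat) (i : 'I_d) (B : set R) :
  measurable B -> measurable [set t : d.-tuple R | B (tnth t i)].
Proof.
move=> mB; have := @measurable_tnth _ R d i measurableT B mB.
by rewrite setTI.
Qed.

Lemma measurable_box (R : realType) (d : nat) (B : 'I_d -> set R) :
  (forall i, measurable (B i)) -> measurable (box B).
Proof.
move=> mB.
rewrite (_ : box B = \big[setI/setT]_(i < d) [set t : d.-tuple R | B i (tnth t i)]).
  by apply: bigsetI_measurable => i _; apply: measurable_tnthR.
apply/seteqP; split => t.
  by move=> h; rewrite -bigcap_seq => i _; apply: h.
by rewrite -bigcap_seq => h i; apply: h => /=; rewrite mem_index_enum.
Qed.

Lemma tuple_sigma_box (R : realType) (d : nat) :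
  @measurable _ (d.-tuple R) =
  <<s [set A | exists2 B : 'I_d -> set R, (forall i, measurable (B i)) & A = box B] >>.
Proof.
apply/seteqP; split.
  apply: smallest_sub; first exact: smallest_sigma_algebra.
  move=> A; rewrite -bigcup_seq => -[i _ [B mB <-]].
  apply: sub_sigma_algebra.
  exists (fun j => if j == i then B else setT).
    by move=> j; case: ifP => // _.
  apply/seteqP; split => t /=.
    by move=> [_ Bt] j; case: eqP => [->|].
  by move=> /(_ i); rewrite /= eqxx.
apply: smallest_sub; first exact: sigma_algebra_measurable.
by move=> _ [B mB ->]; apply: measurable_box.
Qed.

Definition cube (R : realType) (d k : nat) : set (d.-tuple R) :=
  box (fun _ : 'I_d => `[(- k%:R : R), k%:R]%classic).

Lemma lebesgue_tuple_cube (R : realType) (d : nat) (k : nat) :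
  (lebesgue_tuple (@cube R d k) < +oo)%E.
Proof.
rewrite lebesgue_tuple_box // ltey_eq; apply/orP; left.
elim/big_ind : _ => // [x y xf yf|i _]; first exact: fin_numM.
by rewrite lebesgue_measure_itv /=; case: ifP.
Qed.

Lemma bigcup_cube (R : realType) (d : nat) :
  \bigcup_k @cube R d k = setT.
Proof.
apply/seteqP; split => // t _.
exists (Num.truncn (\sum_i `|tnth t i|)).+1 => // i /=.
rewrite in_itv /= -ler_norml; apply: ltW; apply: le_lt_trans (truncnS_gt _).
by rewrite (bigD1 i) //= lerDl; apply: sumr_ge0.
Qed.

(** Boxes are stable under intersection and generate the sigma-algebra. *)
Lemma tuple_measure_unique (R : realType) (d : nat)
    (m1 m2 : {measure set (d.-tuple R) -> \bar R}) :
  (forall B : 'I_d -> set R, (forall i, measurable (B i)) ->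
     m1 (box B) = lebesgue_tuple (box B)) ->
  (forall B : 'I_d -> set R, (forall i, measurable (B i)) ->
     m2 (box B) = lebesgue_tuple (box B)) ->
  forall A, measurable A -> m1 A = m2 A.
Proof.
move=> h1 h2 A mA.
apply: (measure_unique [set A | exists2 B : 'I_d -> set R,
    (forall i, measurable (B i)) & A = box B]
  (@cube R d)) => //.
- exact: tuple_sigma_box.
- move=> _ _ [B mB ->] [B' mB' ->]; exists (fun i => B i `&` B' i).
    by move=> i; apply: measurableI.
  apply/seteqP; split => t /=; first by move=> [h h'] i; split; [apply: h|apply: h'].
  by move=> h; split => i; have [] := h i.
- by move=> k; exists (fun=> `[(- k%:R : R), k%:R]%classic).
- exact: bigcup_cube.
- by move=> _ [B mB ->]; rewrite h1 // h2.
- by move=> k; rewrite /= h1 // lebesgue_tuple_cube.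
Qed.

(** Carries the proof of sigma-finiteness, so that the product measures apply. *)
Definition with_sigma_finite (R : realType) (d : measure_display)
    (T : measurableType d) (m : {measure set T -> \bar R})
    (sf : sigma_finite setT m) : set T -> \bar R := m.

HB.instance Definition _ (R : realType) (d : measure_display)
    (T : measurableType d) (m : {measure set T -> \bar R})
    (sf : sigma_finite setT m) := Measure.on (with_sigma_finite sf).

HB.instance Definition _ (R : realType) (d : measure_display)
    (T : measurableType d) (m : {measure set T -> \bar R})
    (sf : sigma_finite setT m) :=
  Measure_isSigmaFinite.Build _ _ _ (with_sigma_finite sf) sf.

Definition consp (R : realType) (d : nat) (p : R * d.-tuple R) : d.+1.-tuple R :=
  [tuple of p.1 :: p.2].

Lemma measurable_consp (R : realType) (d : nat) :
  measurable_fun setT (@consp R d).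
Proof.
by apply: (@measurable_cons _ _ _ _ fst d snd); [exact: measurable_fst|exact: measurable_snd].
Qed.

(** Each step of the iterated integral is the pushforward, by prepending a
coordinate, of the product of one-dimensional Lebesgue measure with the measure
already built. *)
Lemma lebesgue_tuple_measure (R : realType) (d : nat) :
  exists m : {sigma_finite_measure set (d.-tuple R) -> \bar R},
    forall B, measurable B -> m B = lebesgue_tuple B.
Proof.
suff [m hm] : exists m : {measure set (d.-tuple R) -> \bar R},
    forall B, measurable B -> m B = lebesgue_tuple B.
  have sf : sigma_finite setT m.
    exists (@cube R d); first by rewrite bigcup_cube.
    move=> k; have mc : measurable (@cube R d k) by apply: measurable_box.
    by split => //; rewrite hm ?lebesgue_tuple_cube.
  by exists (with_sigma_finite sf).
elim: d => [|d [m hm]]; first by exists (\d_ [tuple]).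
have sf : sigma_finite setT m.
  exists (@cube R d); first by rewrite bigcup_cube.
  move=> k; have mc : measurable (@cube R d k) by apply: measurable_box.
  by split => //; rewrite hm ?lebesgue_tuple_cube.
exists (pushforward (lebesgue_measure \x with_sigma_finite sf)%E (@consp R d)).
move=> B mB; rewrite /= /pushforward /product_measure1.
apply: eq_integral => x _ /=; rewrite /with_sigma_finite xsectionE.
rewrite hm //.
have := @measurable_consp R d measurableT B mB; rewrite setTI.
by move=> /(measurable_xsection x); rewrite xsectionE.
Unshelve. exact: measurable_consp.
Qed.

(** Product and image measures need a bundled measure; the iterated integral agrees
with this one on measurable sets. *)
Definition tuple_measure (R : realType) (d : nat) : set (d.-tuple R) -> \bar R :=
  sval (cid (lebesgue_tuple_measure R d)).

HB.instance Definition _ (R : realType) (d : nat) :=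
  SigmaFiniteMeasure.copy (@tuple_measure R d) (sval (cid (lebesgue_tuple_measure R d))).

Lemma tuple_measureE (R : realType) (d : nat) (B : set (d.-tuple R)) :
  measurable B -> lebesgue_tuple B = @tuple_measure R d B.
Proof. by move=> mB; rewrite (svalP (cid (lebesgue_tuple_measure R d))). Qed.

Lemma tuple_measure_box (R : realType) (d : nat) (B : 'I_d -> set R) :
  (forall i, measurable (B i)) ->
  @tuple_measure R d (box B) = (\prod_(i < d) lebesgue_measure (B i))%E.
Proof.
by move=> mB; have E := tuple_measureE (measurable_box mB); rewrite -E lebesgue_tuple_box.
Qed.

Lemma tuple_measureP (R : realType) (d : nat)
    (m : {measure set (d.-tuple R) -> \bar R}) :
  (forall B : 'I_d -> set R, (forall i, measurable (B i)) ->
     m (box B) = (\prod_(i < d) lebesgue_measure (B i))%E) ->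
  forall A, measurable A -> m A = @tuple_measure R d A.
Proof.
move=> h A mA; apply: tuple_measure_unique => // B mB.
  by rewrite h // lebesgue_tuple_box.
by rewrite (tuple_measureE (measurable_box mB)).
Qed.

(** The coordinates to be integrated out are not the last ones, so the two groups
are interleaved as [e] prescribes. *)
Definition glue (R : realType) (a b N : nat) (e : 'I_N -> 'I_a + 'I_b)
    (p : a.-tuple R * b.-tuple R) : N.-tuple R :=
  [tuple (match e i with inl j => tnth p.1 j | inr j => tnth p.2 j end) | i < N].

Lemma measurable_glue (R : realType) (a b N : nat) (e : 'I_N -> 'I_a + 'I_b) :
  measurable_fun setT (@glue R a b N e).
Proof.
apply/measurable_fun_tnthP => i.
have -> : (@tnth N R ^~ i \o glue e) =
    fun p => match e i with inl j => tnth p.1 j | inr j => tnth p.2 j end.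
  by apply/funext => p; rewrite /= tnth_mktuple.
case: (e i) => j.
  apply: (measurableT_comp (f := fun t => tnth t j)); first exact: measurable_tnth.
  exact: measurable_fst.
apply: (measurableT_comp (f := fun t => tnth t j)); first exact: measurable_tnth.
exact: measurable_snd.
Qed.

(** Both sides are measures that give a box the product of its side lengths. *)
Lemma tuple_measure_glue (R : realType) (a b N : nat) (e : 'I_N -> 'I_a + 'I_b)
    (A : set (N.-tuple R)) :
  bijective e -> measurable A ->
  @tuple_measure R N A =
  (@tuple_measure R a \x @tuple_measure R b)%E (glue e @^-1` A).
Proof.
move=> be mA.
pose m := pushforward (@tuple_measure R a \x @tuple_measure R b)%E (glue e).
have mg := @measurable_glue R a b N e.
symmetry; apply: (@tuple_measureP R N
  (measure_function_pushforward__canonical__measure_function_Measure _ mg)) => // B mB /=.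
have [g eg ge] := be.
have bE : glue e @^-1` box B = box (B \o g \o inl) `*` box (B \o g \o inr).
  apply/seteqP; split => -[u w] /=.
    move=> h; split => j /=.
      by have := h (g (inl j)); rewrite /glue tnth_mktuple ge.
    by have := h (g (inr j)); rewrite /glue tnth_mktuple ge.
  move=> [hu hw] i; rewrite /glue tnth_mktuple; case E : (e i) => [j|j].
    by have := hu j; rewrite /= -E eg.
  by have := hw j; rewrite /= -E eg.
rewrite /pushforward bE product_measure1E; [|by apply: measurable_box => i; apply: mB..].
transitivity ((\prod_(j < a) lebesgue_measure (B (g (inl j)))) *
              (\prod_(j < b) lebesgue_measure (B (g (inr j)))))%E.
  by congr (_ * _)%E; apply: tuple_measure_box => i; apply: mB.
rewrite [RHS](reindex g) /=; last by exists e => x _; [exact: ge|exact: eg].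
by rewrite big_sumType.
Qed.

(** * Affine images and Euclidean balls *)

Lemma measurable_affine1 (R : realType) (c a : R) :
  measurable_fun setT (fun x : R => c + a * x).
Proof. by apply: measurable_funD => //; apply: measurable_funM. Qed.

Lemma lebesgue_measure_affine (R : realType) (c a : R) (B : set R) :
  0 < a -> measurable B ->
  (a%:E * lebesgue_measure ((fun x : R => (c + a * x)%R) @^-1` B) =
   lebesgue_measure B)%E.
Proof.
move=> a0 mB.
have mg : measurable_fun setT (fun x : measurableTypeR R => (c + a * x)%R : measurableTypeR R).
  exact: measurable_affine1.
pose an : {nonneg R} := NngNum (ltW a0).
pose m := mscale an (measure_function_pushforward__canonical__measure_function_Measure
  (@lebesgue_measure R) mg).
symmetry; apply: (@lebesgue_measure_unique R m) => // _ [[u v] _ <-].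
rewrite /m /mscale /= /pushforward.
pose I : set R := `](u - c) / a, (v - c) / a]%classic.
transitivity (a%:E * lebesgue_measure I)%E; last first.
  congr (_ * lebesgue_measure _)%E.
  apply/seteqP; split => x; rewrite /I /= !in_itv /= ltr_pdivrMr // ler_pdivlMr //
    ltrBlDl lerBrDl (mulrC x) //.
rewrite /I !lebesgue_measure_itv /= !lte_fin ltr_pM2r ?invr_gt0 // ltrD2r.
case: ifP => _; last by rewrite mule0.
rewrite -!EFinB -EFinM; congr EFin; field; exact: lt0r_neq0.
Qed.

Definition affine (R : realType) (d : nat) (c : 'I_d -> R) (a : R)
    (t : d.-tuple R) : d.-tuple R := [tuple c i + a * tnth t i | i < d].

Lemma measurable_affine (R : realType) (d : nat) (c : 'I_d -> R) (a : R) :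
  measurable_fun setT (affine c a).
Proof.
apply/measurable_fun_tnthP => i.
have -> : (@tnth d R ^~ i \o affine c a) = (fun x => c i + a * x) \o (fun t => tnth t i).
  by apply/funext => p; rewrite /= tnth_mktuple.
apply: measurableT_comp; first exact: measurable_affine1.
exact: measurable_tnth.
Qed.

(** The two sides are measures that agree on boxes, one coordinate at a time. *)
Lemma tuple_measure_affine (R : realType) (d : nat) (c : 'I_d -> R) (a : R)
    (A : set (d.-tuple R)) :
  0 < a -> measurable A ->
  ((a ^+ d)%:E * tuple_measure (affine c a @^-1` A) = tuple_measure A)%E.
Proof.
move=> a0 mA.
have mg := measurable_affine c a.
pose an : {nonneg R} := NngNum (exprn_ge0 d (ltW a0)).
pose m := mscale an (measure_function_pushforward__canonical__measure_function_Measure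
  (@tuple_measure R d) mg).
apply: (@tuple_measureP R d m) => // B mB.
rewrite /m /mscale /= /pushforward.
have boxE : affine c a @^-1` box B =
    box (fun i => (fun x : R => (c i + a * x)%R) @^-1` B i).
  by apply/seteqP; split => t h i; have := h i; rewrite /affine tnth_mktuple.
have mB' i : measurable ((fun x : R => (c i + a * x)%R) @^-1` B i).
  by rewrite -[X in measurable X]setTI; apply: measurable_affine1.
transitivity ((a ^+ d)%:E * tuple_measure
    (box (fun i => (fun x : R => (c i + a * x)%R) @^-1` B i)))%E.
  by rewrite -boxE.
have E := tuple_measure_box mB'; rewrite E.
have -> : a ^+ d = \prod_(i < d) a by rewrite prodr_const card_ord.
rewrite -prodEFin -big_split /=; apply: eq_bigr => i _.
exact: lebesgue_measure_affine.
Qed.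

Definition tball (R : realType) (d : nat) (c : 'I_d -> R) (s : R) :
    set (d.-tuple R) :=
  [set t | \sum_i (tnth t i - c i) ^+ 2 <= s ^+ 2].

Lemma measurable_le_cst (R : realType) (d : measure_display)
    (T : measurableType d) (f : T -> R) (s : R) :
  measurable_fun setT f -> measurable [set t | f t <= s].
Proof.
move=> mf; have := mf measurableT `]-oo, s]%classic (measurable_itv _).
rewrite setTI; congr measurable; apply/seteqP; split => t /=; by rewrite in_itv.
Qed.

Lemma measurable_tball (R : realType) (d : nat) (c : 'I_d -> R) (s : R) :
  measurable (tball c s).
Proof.
apply: measurable_le_cst; apply: measurable_sum => i.
apply: measurable_funX; apply: measurable_funB => //; exact: measurable_tnth.
Qed.

Lemma tball_affine (R : realType) (d : nat) (c : 'I_d -> R) (s : R) :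
  0 < s -> affine c s @^-1` tball c s = tball (fun=> 0) 1.
Proof.
move=> s0; apply/seteqP; split => t /=; rewrite /tball /=.
  move=> h; rewrite -(ler_pM2l (exprn_gt0 2 s0)) expr1n mulr1.
  apply: le_trans h; rewrite le_eqVlt; apply/orP; left; apply/eqP.
  rewrite mulr_sumr; apply: eq_bigr => i _.
  by rewrite /affine tnth_mktuple subr0 addrC addKr exprMn.
move=> h; rewrite -[leRHS]mulr1 -[X in _ * X](expr1n _ 2).
rewrite -(ler_pM2l (exprn_gt0 2 s0)) in h; apply: le_trans h.
rewrite le_eqVlt; apply/orP; left; apply/eqP.
rewrite mulr_sumr; apply: eq_bigr => i _.
by rewrite /affine tnth_mktuple subr0 addrC addKr exprMn.
Qed.

Lemma tuple_measure_tball (R : realType) (d : nat) (c : 'I_d -> R) (s : R) :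
  0 < s ->
  tuple_measure (tball c s) =
  ((s ^+ d)%:E * tuple_measure (tball (fun _ : 'I_d => 0%R) 1))%E.
Proof.
move=> s0; rewrite -(tball_affine c s0).
by rewrite (tuple_measure_affine c s0 (measurable_tball c s)).
Qed.

Lemma tuple_measure_cube (R : realType) (d k : nat) :
  (tuple_measure (@cube R d k) < +oo)%E.
Proof.
have mc : measurable (@cube R d k) by apply: measurable_box.
by have E := tuple_measureE mc; rewrite -E lebesgue_tuple_cube.
Qed.

Lemma tuple_measure_unit_tball (R : realType) (d : nat) :
  tuple_measure (tball (fun _ : 'I_d => (0 : R)) 1) \is a fin_num.
Proof.
rewrite ge0_fin_numE //; apply: le_lt_trans (@tuple_measure_cube R d 1).
apply: le_measure; rewrite ?inE; first exact: measurable_tball.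
  by apply: measurable_box.
move=> t; rewrite /tball /= => h i /=; rewrite in_itv /= -ler_norml.
rewrite -(@ler_sqr R) ?nnegrE // real_normK ?num_real //; apply: le_trans h.
rewrite (bigD1 i) //= subr0 lerDl; apply: sumr_ge0 => j _; exact: sqr_ge0.
Qed.

(** * Sets with thin fibers fill a small part of a ball *)

Lemma expR1_le4 (R : realType) : expR 1 <= 4 :> R.
Proof.
have h : expR (- (1/2)) >= 1/2 :> R.
  by apply: le_trans (expR_ge1Dx _); lra.
have h2 : expR (1/2) <= 2 :> R.
  have := expRN (- (1/2) : R); rewrite opprK => ->.
  by rewrite -[leRHS]invrK lef_pV2 ?posrE ?expR_gt0 //; lra.
have -> : (1 : R) = 1/2 + 1/2 by lra.
rewrite expRD; have := expR_gt0 (1/2 : R); nra.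
Qed.

(** What shrinking the ball in [a] of the [a + b] coordinates costs: the square root
of (1 + b/a)^a <= e^b <= 4^b. The [maxn] keeps the radius positive when [a = 0]. *)
Lemma shrink_factor (R : realType) (a b : nat) :
  1 <= 2 ^+ b * Num.sqrt ((maxn a 1)%:R / (a + b)%:R : R) ^+ a.
Proof.
case: a => [|a]; first by rewrite expr0 mulr1 exprn_ege1 // ler1n.
rewrite (maxn_idPl _) //.
have N0 : 0 < (a.+1 + b)%:R :> R by rewrite ltr0n addSn.
have q0 : 0 < (a.+1%:R / (a.+1 + b)%:R : R) by rewrite divr_gt0 // ltr0n.
rewrite -(@ler_pXn2r R 2) ?nnegrE ?mulr_ge0 ?exprn_ge0 ?sqrtr_ge0 //.
rewrite expr1n exprMn -!exprM mulnC (mulnC a.+1) !exprM (sqr_sqrtr (ltW q0)).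
rewrite -[a.+1%:R / _]invrK exprVn ler_pdivlMr ?exprn_gt0 ?invr_gt0 //.
rewrite mul1r invf_div.
have -> : (a.+1 + b)%:R / a.+1%:R = 1 + b%:R / a.+1%:R :> R.
  by rewrite natrD mulrDl divff // pnatr_eq0.
have b0 : 0 <= (b%:R / a.+1%:R : R) by rewrite divr_ge0.
apply: (@le_trans _ _ (expR (b%:R / a.+1%:R) ^+ a.+1)).
  by rewrite ler_pXn2r ?nnegrE ?expR_ge0 ?expR_ge1Dx // addr_ge0.
rewrite -expRM_natl mulrC divfK ?pnatr_eq0 //.
rewrite -[b%:R]mulr1 expRM_natl; apply: lerXn2r.
- by rewrite nnegrE expR_ge0.
- by rewrite nnegrE exprn_ge0.
by apply: le_trans (expR1_le4 R) _; lra.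
Qed.

Section ThinFibers.
Variables (R : realType) (a b N : nat) (e : 'I_N -> 'I_a + 'I_b).
Hypothesis be : bijective e.

Lemma sum_split (f : 'I_N -> R) (g : 'I_a + 'I_b -> 'I_N) :
  cancel e g -> cancel g e ->
  \sum_i f i = \sum_j f (g (inl j)) + \sum_j f (g (inr j)).
Proof.
move=> eg ge; rewrite (reindex g) /=; last by exists e => x _; [exact: ge|exact: eg].
by rewrite big_sumType.
Qed.

Lemma card_split : N = (a + b)%N.
Proof.
have := bij_eq_card be; rewrite card_sum !card_ord //.
Qed.

(** Integrate over the first [a] coordinates: each fiber lies in a box with sides
[l], and the nonempty fibers lie over a ball of radius [s]. *)
Lemma thin_fibers (c : 'I_N -> R) (s : R) (l : 'I_b -> R) (A : set (N.-tuple R)) :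
  0 < s -> (forall j, 0 <= l j) -> measurable A -> A `<=` tball c s ->
  (forall u w w', A (glue e (u, w)) -> A (glue e (u, w')) ->
     forall j, tnth w j - tnth w' j <= l j) ->
  (tuple_measure A <=
   (s ^+ a * \prod_j l j)%:E * tuple_measure (tball (fun _ : 'I_a => 0%R) 1))%E.
Proof.
move=> s0 l0 mA Ab Al; rewrite (tuple_measure_glue be mA) /product_measure1.
have [g eg ge] := be.
have L0 : 0 <= \prod_j l j by apply: prodr_ge0.
pose B1 := tball (c \o g \o inl) s.
have mB1 : measurable B1 := measurable_tball _ _.
have mg : measurable (glue e @^-1` A).
  by rewrite -[X in measurable X]setTI; apply: measurable_glue.
apply: (@le_trans _ _ (\int[@tuple_measure R a]_u
    ((\prod_j l j)%:E * (\1_B1 u)%:E))%E).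
  apply: ge0_le_integral => //.
  - exact: measurable_fun_xsection.
  - by apply/measurable_EFinP; apply: measurable_funM.
  move=> u _ /=.
  have [->|/set0P[w0 Aw0]] := eqVneq (xsection (glue e @^-1` A) u) set0.
    by rewrite measure0 -EFinM lee_fin mulr_ge0 // prodr_ge0.
  have Aglue w : xsection (glue e @^-1` A) u w -> A (glue e (u, w)).
    by rewrite xsectionE.
  have B1u : B1 u.
    have := Ab _ (Aglue _ Aw0); rewrite /tball /= (sum_split _ eg ge) => h.
    apply: le_trans h; rewrite -[leLHS]addr0; apply: lerD; last first.
      by apply: sumr_ge0 => j _; exact: sqr_ge0.
    by apply: ler_sum => j _; rewrite /glue tnth_mktuple ge.
  rewrite indicE mem_set // mule1.
  pose S j := [set tnth w j | w in xsection (glue e @^-1` A) u].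
  have S0 j : S j !=set0 by exists (tnth w0 j), w0.
  have Sl j : lbound (S j) (tnth w0 j - l j).
    move=> _ [w Aw <-]; rewrite lerBlDr -lerBlDl.
    exact: Al (Aglue _ Aw0) (Aglue _ Aw) j.
  have hS j : has_lbound (S j) by exists (tnth w0 j - l j).
  pose I j : set R := `[inf (S j), inf (S j) + l j]%classic.
  have mI : measurable (box I) by apply: measurable_box => j; exact: measurable_itv.
  apply: (@le_trans _ _ (tuple_measure (box I))).
    apply: le_measure; rewrite ?inE //; first exact: measurable_xsection.
    move=> w Aw j; rewrite /I /= in_itv /=; apply/andP; split.
      by apply: ge_inf => //; exists w.
    rewrite -lerBlDr; apply: lb_le_inf => // _ [w' Aw' <-].
    rewrite lerBlDr -lerBlDl.
    exact: Al (Aglue _ Aw) (Aglue _ Aw') j.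
  have E := @tuple_measure_box R b I (fun j => measurable_itv _); rewrite E.
  rewrite -prodEFin le_eqVlt; apply/orP; left; apply/eqP; apply: eq_bigr => j _.
  rewrite /I lebesgue_measure_itv /= lte_fin ltrDl.
  case: ltP => lj; first by rewrite -EFinB addrC addKr.
  by congr EFin; apply/le_anti; rewrite l0 lj.
rewrite ge0_integralZl_EFin //; last first.
  by apply/measurable_EFinP.
rewrite integral_indic // setIT.
have E := tuple_measure_tball (c \o g \o inl) s0.
by rewrite mulrC EFinM -muleA -E.
Qed.

(** The ball contains the product of a smaller ball and a cube. *)
Lemma tball_fat (c : 'I_N -> R) (s r h : R) :
  0 < r -> 0 <= h -> (0 < a)%:R * r ^+ 2 + b%:R * h ^+ 2 <= s ^+ 2 ->
  ((r ^+ a * (2 * h) ^+ b)%:E * tuple_measure (tball (fun _ : 'I_a => 0%R) 1) <=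
   tuple_measure (tball c s))%E.
Proof.
move=> r0 h0 rhs; have [g eg ge] := be.
rewrite (tuple_measure_glue be (measurable_tball c s)).
pose I j : set R := `[c (g (inr j)) - h, c (g (inr j)) + h]%classic.
have mI : measurable (box I) by apply: measurable_box => j; exact: measurable_itv.
have E := @tuple_measure_box R b I (fun j => measurable_itv _).
have mB1 := measurable_tball (c \o g \o inl) r.
apply: (@le_trans _ _ ((@tuple_measure R a \x @tuple_measure R b)%E
    (tball (c \o g \o inl) r `*` box I))).
  have -> : ((@tuple_measure R a \x @tuple_measure R b)
      (tball (c \o g \o inl) r `*` box I) =
      tuple_measure (tball (c \o g \o inl) r) * tuple_measure (box I))%E.
    exact: product_measure1E.
  have E1 := tuple_measure_tball (c \o g \o inl) r0; rewrite E1.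
  rewrite (_ : tuple_measure (box I) = ((2 * h) ^+ b)%:E).
    by rewrite EFinM -!muleA (muleC (tuple_measure _)).
  rewrite E; have -> : (2 * h) ^+ b = \prod_(j < b) (2 * h) by rewrite prodr_const card_ord.
  rewrite -prodEFin; apply: eq_bigr => j _.
  rewrite /I lebesgue_measure_itv /= lte_fin.
  case: ltP => lj; first by rewrite -EFinB; congr EFin; ring.
  by congr EFin; apply/le_anti; lra.
apply: le_measure; rewrite ?inE; first exact: measurableX.
  by rewrite -[X in measurable X]setTI; apply: measurable_glue => //; exact: measurable_tball.
move=> [u w] [/= hu hw]; rewrite /tball /= (sum_split _ eg ge).
apply: le_trans rhs; apply: lerD.
  case: (posnP a) => [a0|a0]; last first.
    rewrite mul1r; apply: le_trans hu.
    by apply: ler_sum => j _; rewrite /glue tnth_mktuple ge.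
  rewrite big1 => [|j _]; first by apply: mulr_ge0; [exact: ler0n|exact: sqr_ge0].
  by have := ltn_ord j; rewrite {2}a0.
have -> : b%:R * h ^+ 2 = \sum_(j < b) h ^+ 2 by rewrite sumr_const card_ord mulr_natl.
apply: ler_sum => j _; rewrite /glue tnth_mktuple ge.
have := hw j; rewrite /I /= in_itv /= => /andP[h1 h2].
nra.
Qed.

(** Compare [thin_fibers] with [tball_fat] for the radius [s * sqrt (a / N)] and
the half side [s / sqrt N]. The volume of the [a]-dimensional unit ball occurs on
both sides, so it never has to be evaluated. *)
Lemma thin_fibers_ratio (M : nat) (c : 'I_N -> R) (s : R) (l : 'I_b -> R)
    (A : set (N.-tuple R)) :
  (0 < N)%N -> (N <= M ^ 2)%N ->
  0 < s -> (forall j, 0 <= l j) -> measurable A -> A `<=` tball c s ->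
  (forall u w w', A (glue e (u, w)) -> A (glue e (u, w')) ->
     forall j, tnth w j - tnth w' j <= l j) ->
  ((s ^+ b)%:E * tuple_measure A <=
   (M%:R ^+ b * \prod_j l j)%:E * tuple_measure (tball c s))%E.
Proof.
move=> N0 NM s0 l0 mA Ab Al.
have := thin_fibers s0 l0 mA Ab Al.
pose r := s * Num.sqrt ((maxn a 1)%:R / N%:R).
pose h := s / Num.sqrt N%:R.
have NR : 0 < N%:R :> R by rewrite ltr0n.
have r0 : 0 < r by rewrite mulr_gt0 // sqrtr_gt0 divr_gt0 // ltr0n leq_max orbT.
have h0 : 0 <= h by rewrite divr_ge0 ?sqrtr_ge0 // ltW.
have rh : (0 < a)%:R * r ^+ 2 + b%:R * h ^+ 2 <= s ^+ 2.
  rewrite /r /h !exprMn exprVn !sqr_sqrtr ?divr_ge0 ?ler0n //.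
  have -> : (0 < a)%:R * (s ^+ 2 * ((maxn a 1)%:R / N%:R)) = s ^+ 2 * (a%:R / N%:R) :> R.
    case: (a) => [|a']; first by rewrite !mul0r mulr0.
    by rewrite mul1r (maxn_idPl _).
  rewrite (mulrCA b%:R) -mulrDr -mulrDl -natrD -card_split divff ?mulr1 // lt0r_neq0 //.
have := tball_fat c r0 h0 rh.
set V := tuple_measure (tball (fun _ : 'I_a => 0) 1) => fat thin.
have V0 : (0 <= V)%E by exact: measure_ge0.
have L0 : 0 <= \prod_j l j by apply: prodr_ge0.
apply: (@le_trans _ _ ((s ^+ b * (s ^+ a * \prod_j l j))%:E * V)%E).
  rewrite EFinM -muleA; apply: lee_wpmul2l => //.
  by rewrite lee_fin exprn_ge0 // ltW.
apply: (@le_trans _ _ ((M%:R ^+ b * \prod_j l j)%:E *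
   ((r ^+ a * (2 * h) ^+ b)%:E * V))%E); last first.
  by apply: lee_wpmul2l => //; rewrite lee_fin mulr_ge0 // exprn_ge0.
rewrite muleA -EFinM; apply: lee_wpmul2r => //; rewrite lee_fin.
have M0 : Num.sqrt N%:R <= M%:R :> R.
  rewrite -(@ler_sqr R) ?nnegrE ?sqrtr_ge0 // sqr_sqrtr // -natrX ler_nat //.
have sN0 : 0 < Num.sqrt N%:R :> R by rewrite sqrtr_gt0.
have hb : s ^+ b <= (M%:R * h) ^+ b.
  apply: lerXn2r; rewrite ?nnegrE ?mulr_ge0 // ?(ltW s0) //.
  by rewrite /h mulrCA ler_peMr ?(ltW s0) // ler_pdivlMr // mul1r.
have := shrink_factor R a b; rewrite -card_split.
set S := Num.sqrt _ => Sh.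
rewrite (_ : r ^+ a = s ^+ a * S ^+ a); last by rewrite /r exprMn.
rewrite (_ : _ * (_ * _ * _) =
   (s ^+ a * \prod_j l j) * ((M%:R * h) ^+ b * (2 ^+ b * S ^+ a))); last first.
  by rewrite !exprMn; ring.
rewrite mulrC; apply: ler_wpM2l; first by rewrite mulr_ge0 // exprn_ge0 // ltW.
apply: le_trans hb _; rewrite ler_peMr // exprn_ge0 // mulr_ge0 //.
Qed.
End ThinFibers.

(** * Approximate kernels normalized on a maximal minor *)

Lemma mxnorm2_le_sqrt (R : realType) (n : nat) (v : 'cV[R]_n) (e : R) :
  0 <= e -> (forall i, `|v i 0| <= e) -> mxnorm2 v <= Num.sqrt n%:R * e.
Proof.
move=> e0 h; rewrite mxnorm2_le ?mulr_ge0 ?sqrtr_ge0 // exprMn sqr_sqrtr //.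
have -> : n%:R * e ^+ 2 = \sum_(i < n) e ^+ 2 by rewrite sumr_const card_ord mulr_natl.
apply: ler_sum => i _; rewrite big_ord1 -expr2 -real_normK ?num_real //.
by rewrite ler_sqr ?nnegrE.
Qed.

(** Laplace expansion along the new row [a], a combination of the rows of [G]. *)
Lemma det_replace_row (R : comUnitRingType) (k : nat) (G : 'M[R]_k) (w : 'rV[R]_k)
    (a : 'I_k) :
  \det (\matrix_(i, j) (if i == a then (w *m G) 0 j else G i j)) = w 0 a * \det G.
Proof.
pose E : 'M[R]_k := \matrix_(i, j) (if i == a then w 0 j else (i == j)%:R).
have -> : \matrix_(i, j) (if i == a then (w *m G) 0 j else G i j) = E *m G.
  apply/matrixP => i j; rewrite !mxE; case ia : (i == a).
    by apply: eq_bigr => l _; rewrite !mxE ia.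
  rewrite (bigD1 i) //= mxE ia eqxx mul1r big1 ?addr0 // => l li.
  by rewrite mxE ia eq_sym (negbTE li) mul0r.
rewrite det_mulmx; congr (_ * _).
rewrite (expand_det_row _ a).
have cE j : cofactor E a j = (a == j)%:R.
  have <- : cofactor (1%:M : 'M[R]_k) a j = (a == j)%:R.
    have := congr1 (fun M : 'M[R]_k => M j a) (mul1mx (\adj (1%:M : 'M[R]_k))).
    rewrite mul_mx_adj det1 !mxE => <-; rewrite eq_sym; by case: eqP.
  rewrite /cofactor; congr (_ * \det _); apply/matrixP => x y; rewrite !mxE.
  by rewrite eq_sym (negbTE (neq_lift a x)).
rewrite (bigD1 a) //= cE eqxx mulr1 mxE eqxx big1 ?addr0 // => j ja.
by rewrite cE eq_sym (negbTE ja) mulr0.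
Qed.

(** Normalizing by a maximal minor keeps all entries in [-1, 1] (Cramer). *)
Lemma maximal_minor_basis (R : realType) (n k : nat) (F : 'M[R]_(n, k)) :
  row_full F ->
  exists (f : {ffun 'I_k -> 'I_n}) (U : 'M[R]_k),
    (forall a b, (F *m U) (f a) b = (a == b)%:R) /\
    (forall i j, `|(F *m U) i j| <= 1).
Proof.
move=> fF.
pose f0 : {ffun 'I_k -> 'I_n} := fullrankfun fF.
have f0u : rowsub f0 F \in unitmx by exact: fullrowsub_unit.
pose m (g : {ffun 'I_k -> 'I_n}) : R := `|\det (rowsub g F)|.
have [f fmax] : exists f, forall g, m g <= m f.
  have [f _ fmax] := @arg_maxP _ _ _ f0 xpredT m isT.
  by exists f => g; exact: fmax.
have fu : rowsub f F \in unitmx.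
  rewrite unitmxE unitfE -normr_gt0; apply: lt_le_trans (fmax f0).
  by rewrite /m normr_gt0 -unitfE -unitmxE.
exists f, (invmx (rowsub f F)); split.
  move=> a b.
  have := mulmxV fu; rewrite mul_rowsub_mx => /matrixP/(_ a b).
  by rewrite [LHS]mxE => ->; rewrite mxE.
move=> i a; set W := F *m _.
pose g := [ffun x => if x == a then i else f x].
have dE : \det (rowsub g F) = W i a * \det (rowsub f F).
  have <- : (row i W) 0 a = W i a by rewrite [LHS]mxE.
  rewrite -det_replace_row; congr (\det _); apply/matrixP => x y.
  rewrite [LHS]mxE [RHS]mxE ffunE; case: eqP => _; last by rewrite mxE.
  by rewrite /W row_mul -mulmxA mulVmx // mulmx1 mxE.
have := fmax g; rewrite /m dE normrM ger_pMl // normr_gt0 -unitfE -unitmxE //.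
Qed.

Lemma rat_approx (R : realType) (x e : R) : `|x| <= 1 -> 0 < e ->
  exists r : rat, [/\ `|ratr r : R| <= 1, `|x - ratr r| <= e &
    forall b : bool, x = b%:R -> ratr r = b%:R :> R].
Proof.
move=> x1 e0.
have [x0|x0] := eqVneq x 0.
  exists 0; rewrite !rmorph0 normr0 x0 subr0 normr0; split => //; first exact: ltW.
have [xo|xo] := eqVneq x 1.
  exists 1; rewrite !rmorph1 normr1 xo subrr normr0; split => //; exact: ltW.
have /andP[xl xr] : -1 <= x <= 1 by rewrite -ler_norml.
have hlt : Num.max (x - e) (-1) < Num.min (x + e) 1.
  by rewrite lt_min !gt_max; apply/andP; split; apply/andP; split; lra.
have [r] := rat_in_itvoo hlt.
rewrite in_itv /= lt_min gt_max => /andP[/andP[h1 h2] /andP[h3 h4]].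
exists r; split.
- by rewrite ler_norml; apply/andP; split; lra.
- by rewrite ler_norml; apply/andP; split; lra.
- by case=> hx; move: x0 xo; rewrite hx eqxx.
Qed.

(** Rational vectors make the exceptional sets countable unions of closed sets,
hence measurable; rounding is done inside [-1, 1] and fixes 0 and 1, at the price
of a slightly larger tolerance. *)
Lemma rat_near_kernel (R : realType) (n k : nat) (f : 'I_k -> 'I_n)
    (M : 'M[R]_n) (W : 'M[R]_(n, k)) (eta eta' : R) :
  (forall a b, W (f a) b = (a == b)%:R) -> (forall i j, `|W i j| <= 1) ->
  (forall j, mxnorm2 (M *m col j W) <= eta) -> eta < eta' ->
  exists V : 'M[rat]_(n, k),
    [/\ forall a b, V (f a) b = (a == b)%:R,
        forall i j, `|ratr (V i j) : R| <= 1 &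
        forall j, mxnorm2 (M *m col j (map_mx ratr V)) <= eta'].
Proof.
move=> Wf W1 MW ee.
pose e := (eta' - eta) / (mxnorm2 M * Num.sqrt n%:R + 1).
have d0 : 0 < mxnorm2 M * Num.sqrt n%:R + 1.
  by rewrite ltr_wpDl // mulr_ge0 ?mxnorm2_ge0 ?sqrtr_ge0.
have e0 : 0 < e by rewrite divr_gt0 // subr_gt0.
have [V hV] : exists V : 'M[rat]_(n, k), forall i j,
    [/\ `|ratr (V i j) : R| <= 1, `|W i j - ratr (V i j)| <= e &
    forall b : bool, W i j = b%:R -> ratr (V i j) = b%:R :> R].
  exists (\matrix_(i < n, j < k) sval (cid (rat_approx (W1 i j) e0))) => i j.
  by rewrite mxE; exact: svalP (cid (rat_approx (W1 i j) e0)).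
exists V; split.
- move=> a b; apply: (fmorph_inj (ratr : rat -> R)).
  by have [_ _ h] := hV (f a) b; rewrite /= ratr_nat; exact: h (Wf a b).
- by move=> i j; have [] := hV i j.
move=> j; have -> : col j (map_mx ratr V) = col j W - (col j W - col j (map_mx ratr V)).
  by rewrite opprB addrC subrK.
rewrite mulmxBr; apply: le_trans (mxnorm2D _ _) _; rewrite mxnorm2N.
have h : mxnorm2 (M *m (col j W - col j (map_mx ratr V))) <= eta' - eta.
  apply: le_trans (mxnorm2_mulv _ _) _.
  have h1 : mxnorm2 (col j W - col j (map_mx ratr V)) <= Num.sqrt n%:R * e.
    apply: mxnorm2_le_sqrt; first exact: ltW.
    by move=> i; rewrite !mxE; have [] := hV i j.
  apply: le_trans (ler_wpM2l (mxnorm2_ge0 _) h1) _.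
  rewrite mulrA /e mulrCA ger_pMr ?subr_gt0 // ler_pdivrMr // mul1r.
  by rewrite lerDl.
have := MW j; lra.
Qed.

(** [W] and [W'] are the identity on the rows [f], so W'^T (M - M') W is the block
of [M - M'] on the rows and columns [f]; it is also W'^T (M W) - (M' W')^T W. *)
Lemma block_rigidity (R : realType) (n k : nat) (f : 'I_k -> 'I_n)
    (M M' : 'M[R]_n) (W W' : 'M[R]_(n, k)) (eta : R) :
  M'^T = M' ->
  (forall i j, M i j != M' i j -> (exists a, i = f a) /\ (exists b, j = f b)) ->
  (forall a b, W (f a) b = (a == b)%:R) -> (forall i j, `|W i j| <= 1) ->
  (forall a b, W' (f a) b = (a == b)%:R) -> (forall i j, `|W' i j| <= 1) ->
  (forall j, mxnorm2 (M *m col j W) <= eta) ->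
  (forall j, mxnorm2 (M' *m col j W') <= eta) ->
  forall a b, M (f a) (f b) - M' (f a) (f b) <= 2 * (Num.sqrt n%:R * eta).
Proof.
move=> M'T MM' Wf W1 W'f W'1 MW M'W' a b.
have finj (g h : 'I_k) : f g = f h -> g = h.
  by move=> gh; apply/eqP; have := Wf g h; rewrite gh Wf eqxx => /eqP;
    rewrite eqr_nat; case: (g == h).
have E : M (f a) (f b) - M' (f a) (f b) =
    mxdot (col a W') ((M - M') *m col b W).
  rewrite /mxdot (bigD1 (f a)) //= big_ord1 [X in _ = _ + X]big1 => [|i ia].
    rewrite addr0 !mxE W'f eqxx mul1r (bigD1 (f b)) //= !mxE Wf eqxx mulr1.
    rewrite [X in _ = _ + X]big1 ?addr0 // => j jb; rewrite !mxE.
    have [->|h] := eqVneq (M (f a) j) (M' (f a) j); first by rewrite subrr mul0r.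
    have [_ [b' jE]] := MM' _ _ h; rewrite jE Wf.
    by case: eqP => [b'b|]; [move: jb; rewrite jE b'b eqxx|rewrite mulr0].
  rewrite big_ord1 !mxE.
  have [[a' iE]|nia] := pselect (exists a', i = f a').
    rewrite iE W'f; case: eqP => [a'a|]; last by rewrite mul0r.
    by move: ia; rewrite iE a'a eqxx.
  rewrite big1 ?mulr0 // => j _; rewrite !mxE.
  have [->|h] := eqVneq (M i j) (M' i j); first by rewrite subrr mul0r.
  by have [] := MM' _ _ h.
have wn (V : 'M[R]_(n, k)) j : (forall i j, `|V i j| <= 1) ->
    mxnorm2 (col j V) <= Num.sqrt n%:R.
  by move=> V1; rewrite -[leRHS]mulr1; apply: mxnorm2_le_sqrt => // i; rewrite mxE.
rewrite E mulmxBl mxdotDr mxdotNr -[X in _ - X]mxdotC mxdot_mull M'T.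
rewrite [X in _ - X]mxdotC.
have eta0 : 0 <= eta by apply: le_trans (MW b); exact: mxnorm2_ge0.
have h1 : mxdot (col a W') (M *m col b W) <= Num.sqrt n%:R * eta.
  apply: le_trans (mxdot_cauchy _ _) _.
  by apply: ler_pM; rewrite ?mxnorm2_ge0 ?wn.
have h2 : `|mxdot (M' *m col a W') (col b W)| <= eta * Num.sqrt n%:R.
  apply: le_trans (mxdot_cauchy_abs _ _) _.
  by apply: ler_pM; rewrite ?mxnorm2_ge0 ?wn.
move: h2; rewrite ler_norml mulrC => /andP[h2 _]; lra.
Qed.

(** * Coordinates of symmetric matrices *)

Lemma split_coordinates (N : nat) (T : {set 'I_N}) :
  exists e : 'I_N -> 'I_#|~: T| + 'I_#|T|,
    bijective e /\ forall i, (i \in T) = (if e i is inr _ then true else false).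
Proof.
pose g (x : 'I_#|~: T| + 'I_#|T|) : 'I_N :=
  match x with inl j => enum_val j | inr j => enum_val j end.
have gT j : g (inr j) \in T by exact: enum_valP.
have gC j : g (inl j) \notin T by have := enum_valP j; rewrite inE.
have ginj : injective g.
  move=> [x|x] [y|y] //= xy.
  - by congr inl; apply: enum_val_inj.
  - by have := gT y; rewrite -[g _]xy => h; have := gC x; rewrite h.
  - by have := gT x; rewrite [g _]xy => h; have := gC y; rewrite h.
  - by congr inr; apply: enum_val_inj.
have [e ge eg] : bijective g.
  by apply: inj_card_bij => //; rewrite card_sum !card_ord addnC cardsC card_ord.
exists e; split; first by exists g.
by move=> i; rewrite -{1}(eg i); case: (e i) => j; [apply/negbTE/gC|apply: gT].
Qed.

(** Reindexing moves the coordinates in [T] to the second group. *)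
Lemma thin_fibers_set (R : realType) (N M : nat) (T : {set 'I_N}) (c : 'I_N -> R)
    (s : R) (L : 'I_N -> R) (A : set (N.-tuple R)) :
  (0 < N)%N -> (N <= M ^ 2)%N -> 0 < s -> (forall i, 0 <= L i) ->
  measurable A -> A `<=` tball c s ->
  (forall t t', A t -> A t' -> (forall i, i \notin T -> tnth t i = tnth t' i) ->
     forall i, i \in T -> tnth t i - tnth t' i <= L i) ->
  ((s ^+ #|T|)%:E * tuple_measure A <=
   (M%:R ^+ #|T| * \prod_(i in T) L i)%:E * tuple_measure (tball c s))%E.
Proof.
move=> N0 NM s0 L0 mA Ab Al; have [e [be eT]] := split_coordinates T.
have [g eg ge] := be.
have -> : \prod_(i in T) L i = \prod_(j < #|T|) L (g (inr j)).
  rewrite (reindex g) /=; last by exists e => x _; [exact: ge|exact: eg].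
  rewrite big_sumType /= big_pred0 ?mul1r => [|j]; last by rewrite eT ge.
  by apply: eq_bigl => j; rewrite eT ge.
apply: (thin_fibers_ratio be N0 NM s0 _ mA Ab) => // u w w' Aw Aw' j.
have := Al _ _ Aw Aw' _ (g (inr j)); rewrite /glue !tnth_mktuple ge; apply.
  by move=> i; rewrite eT !tnth_mktuple; case: (e i).
by rewrite eT ge.
Qed.

Lemma upper_pair_proof (n : nat) (i j : 'I_n) :
  let p := if (i <= j)%N then (i, j) else (j, i) in (p.1 <= p.2)%N.
Proof. by case: leqP => //= /ltnW. Qed.

Definition coord_of_entry (n : nat) (i j : 'I_n) : 'I_#|uppair n| :=
  enum_rank (Sub (if (i <= j)%N then (i, j) else (j, i)) (upper_pair_proof i j)
             : uppair n).

Definition entry_of_coord (n : nat) (t : 'I_#|uppair n|) : 'I_n * 'I_n := val (enum_val t).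

Lemma entry_of_coordP (n : nat) (t : 'I_#|uppair n|) :
  ((entry_of_coord t).1 <= (entry_of_coord t).2)%N.
Proof. by rewrite /entry_of_coord; case: (enum_val t). Qed.

Lemma coord_of_entryK (n : nat) (i j : 'I_n) :
  entry_of_coord (coord_of_entry i j) = if (i <= j)%N then (i, j) else (j, i).
Proof. by rewrite /entry_of_coord /coord_of_entry enum_rankK. Qed.

Lemma entry_of_coordK (n : nat) (t : 'I_#|uppair n|) :
  coord_of_entry (entry_of_coord t).1 (entry_of_coord t).2 = t.
Proof.
apply: enum_val_inj; apply: val_inj; rewrite -/(entry_of_coord _) coord_of_entryK entry_of_coordP.
by rewrite -surjective_pairing.
Qed.

Lemma coord_of_entryC (n : nat) (i j : 'I_n) : coord_of_entry i j = coord_of_entry j i.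
Proof.
apply: enum_val_inj; apply: val_inj; rewrite -!/(entry_of_coord _) !coord_of_entryK.
by case: ltngtP => // ij; congr pair; apply: val_inj.
Qed.

Lemma big_uppair (R : Type) (idx : R) (op : Monoid.com_law idx) (n : nat)
    (P : pred ('I_n * 'I_n)) (F : 'I_n * 'I_n -> R) :
  \big[op/idx]_(t < #|uppair n| | P (entry_of_coord t)) F (entry_of_coord t) =
  \big[op/idx]_(p | P p && (p.1 <= p.2)%N) F p.
Proof.
rewrite [RHS](reindex_omap (@entry_of_coord n)
   (fun p : 'I_n * 'I_n => Some (coord_of_entry p.1 p.2))) /=.
  apply: eq_bigl => t; rewrite entry_of_coordP andbT entry_of_coordK eqxx andbT //.
by move=> p /andP[_ p12]; rewrite coord_of_entryK p12 -surjective_pairing.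
Qed.

Definition svec_weight (R : realType) (p : nat * nat) : R :=
  if p.1 == p.2 then 1 else Num.sqrt 2.

Lemma svec_weight_gt0 (R : realType) (p : nat * nat) : 0 < svec_weight R p.
Proof. by rewrite /svec_weight; case: ifP => // _; rewrite sqrtr_gt0. Qed.

Lemma svec_weight_neq0 (R : realType) (p : nat * nat) : svec_weight R p != 0.
Proof. by rewrite lt0r_neq0 // svec_weight_gt0. Qed.

Lemma tnth_svec (R : realType) (n : nat) (X : symmx R n) (t : 'I_#|uppair n|) :
  tnth (svec X) t =
  svec_weight R (val (entry_of_coord t).1, val (entry_of_coord t).2) *
    (val X) (entry_of_coord t).1 (entry_of_coord t).2.
Proof. by rewrite /svec tnth_mktuple. Qed.

Lemma smat_subproof (R : realType) (n : nat) (t : #|uppair n|.-tuple R) :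
  (\matrix_(i, j) (tnth t (coord_of_entry i j) / svec_weight R (val i, val j))) \in symv R n.
Proof.
apply/symvP/matrixP => i j; rewrite !mxE coord_of_entryC; congr (_ / _).
by rewrite /svec_weight /= eq_sym.
Qed.

Definition smat (R : realType) (n : nat) (t : #|uppair n|.-tuple R) : symmx R n :=
  Subvs (smat_subproof t).

Lemma smatK (R : realType) (n : nat) : cancel (@smat R n) (@svec R n).
Proof.
move=> t; apply: eq_from_tnth => i; rewrite tnth_svec /= mxE entry_of_coordK.
by rewrite mulrC divfK ?svec_weight_neq0.
Qed.

Lemma symmx_sym (R : realType) (n : nat) (X : symmx R n) i j :
  (val X) i j = (val X) j i.
Proof. by have /matrixP/(_ i j) := symvP _ (subvsP X); rewrite mxE. Qed.

Lemma svecK (R : realType) (n : nat) : cancel (@svec R n) (@smat R n).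
Proof.
move=> X; apply: val_inj; apply/matrixP => i j; rewrite /= mxE tnth_svec coord_of_entryK.
case: leqP => ij /=; first by rewrite mulrC mulKf ?svec_weight_neq0.
have -> : svec_weight R (val i, val j) = svec_weight R (val j, val i).
  by rewrite /svec_weight /= eq_sym.
by rewrite mulrC mulKf ?svec_weight_neq0 // symmx_sym.
Qed.

(** Off-diagonal entries occur twice in the full sum, whence the weight [sqrt 2] in
[svec]. *)
Lemma sum_symmetric (R : realType) (n : nat) (F : 'I_n * 'I_n -> R) :
  (forall i j, F (i, j) = F (j, i)) ->
  \sum_i \sum_j F (i, j) =
  \sum_(p : 'I_n * 'I_n | (p.1 <= p.2)%N) svec_weight R (val p.1, val p.2) ^+ 2 * F p.
Proof.
move=> Fsym; rewrite pair_big /=.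
rewrite (eq_bigr F); last by case.
rewrite (bigID (fun p : 'I_n * 'I_n => p.1 <= p.2)%N) /=.
have -> : \sum_(p : 'I_n * 'I_n | ~~ (p.1 <= p.2)%N) F p =
    \sum_(p : 'I_n * 'I_n | (p.1 < p.2)%N) F p.
  rewrite (reindex_inj (h := fun p : 'I_n * 'I_n => (p.2, p.1))) /=.
    by apply: eq_big => -[i j] /=; rewrite -?ltnNge.
  by move=> [i j] [i' j'] [-> ->].
rewrite (bigID (fun p : 'I_n * 'I_n => p.1 == p.2)) /=.
rewrite [RHS](bigID (fun p : 'I_n * 'I_n => p.1 == p.2)) /= -addrA; congr (_ + _).
  apply: eq_bigr => p /andP[_ /eqP pE].
  by rewrite /svec_weight /= pE eqxx expr1n mul1r.
have -> : \sum_(p : 'I_n * 'I_n | (p.1 < p.2)%N) F p =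
    \sum_(p : 'I_n * 'I_n | (p.1 <= p.2)%N && (p.1 != p.2)) F p.
  by apply: eq_bigl => p; rewrite ltn_neqAle andbC -val_eqE.
rewrite -big_split /=; apply: eq_bigr => p /andP[_ pE].
by rewrite /svec_weight /= val_eqE (negbTE pE) sqr_sqrtr // mulr_natl.
Qed.

Lemma svec_isometry (R : realType) (n : nat) (X Y : symmx R n) :
  \sum_t (tnth (svec X) t - tnth (svec Y) t) ^+ 2 = mxnorm2 (val X - val Y) ^+ 2.
Proof.
pose F (p : 'I_n * 'I_n) := ((val X) p.1 p.2 - (val Y) p.1 p.2) ^+ 2.
transitivity (\sum_(t < #|uppair n|)
    (svec_weight R (val (entry_of_coord t).1, val (entry_of_coord t).2) ^+ 2 * F (entry_of_coord t))).
  by apply: eq_bigr => t _; rewrite !tnth_svec -mulrBr exprMn.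
have /= -> := big_uppair +%R xpredT (fun p => svec_weight R (val p.1, val p.2) ^+ 2 * F p).
rewrite -sum_symmetric => [|i j]; last by rewrite /F /= (symmx_sym X) (symmx_sym Y).
rewrite sqr_mxnorm2; apply: eq_bigr => i _; apply: eq_bigr => j _.
by rewrite /F /= !mxE expr2.
Qed.

Lemma svec_frob_ball (R : realType) (n : nat) (Z : symmx R n) (s : R) : 0 <= s ->
  @svec R n @` frob_ball Z s = tball (fun t => tnth (svec Z) t) s.
Proof.
move=> s0; apply/seteqP; split => [_ [X XZ <-]|t].
  by rewrite /tball /= svec_isometry ler_sqr ?nnegrE ?mxnorm2_ge0.
rewrite /tball /= -{1}(smatK t) svec_isometry ler_sqr ?nnegrE ?mxnorm2_ge0 // => h.
by exists (smat t); rewrite ?smatK.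
Qed.

Lemma card_uppair_gt0 (n : nat) : (0 < n)%N -> (0 < #|uppair n|)%N.
Proof.
move=> n0; apply/card_gt0P.
by exists (enum_val (coord_of_entry (Ordinal n0) (Ordinal n0))).
Qed.

Lemma card_uppair_le (n : nat) : (#|uppair n| <= n ^ 2)%N.
Proof.
have -> : (n ^ 2)%N = #|{: 'I_n * 'I_n}| by rewrite card_prod card_ord mulnn.
have inj : injective (@entry_of_coord n).
  by apply: can_inj (fun p => coord_of_entry p.1 p.2) _; exact: entry_of_coordK.
by have := leq_card _ inj; rewrite card_ord.
Qed.

Definition block_coords (n : nat) (I : {set 'I_n}) : {set 'I_#|uppair n|} :=
  [set t | ((entry_of_coord t).1 \in I) && ((entry_of_coord t).2 \in I)]%SET.

(** The pairs of elements of [I] lie above, below or on the diagonal, and the first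
two kinds are exchanged by transposition. *)
Lemma card_offdiag_pairs (n : nat) (I : {set 'I_n}) :
  #|[set p : 'I_n * 'I_n | [&& p.1 \in I, p.2 \in I & (p.1 < p.2)%N]]%SET| = 'C(#|I|, 2).
Proof.
pose A := [set p : 'I_n * 'I_n | [&& p.1 \in I, p.2 \in I & (p.1 < p.2)%N]]%SET.
pose B := [set p : 'I_n * 'I_n | [&& p.1 \in I, p.2 \in I & (p.2 < p.1)%N]]%SET.
pose D := [set (i, i) | i in I]%SET.
have AB : #|B| = #|A|.
  rewrite -(card_imset A (f := fun p => (p.2, p.1))); last by move=> [? ?] [? ?] [-> ->].
  apply: eq_card => -[i j]; rewrite inE /=; apply/and3P/imsetP => [[h1 h2 h3]|].
    by exists (j, i) => //; rewrite inE /= h1 h2 h3.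
  by move=> [[i' j']]; rewrite inE /= => /and3P[h1 h2 h3] [-> ->].
have cD : #|D| = #|I| by rewrite card_imset // => ? ? [].
have AD : (A :&: B)%SET = finset.set0.
  by apply/setP => -[i j]; rewrite !inE /=; case: ltngtP; rewrite ?andbF.
have ABD : ((A :|: B) :&: D)%SET = finset.set0.
  apply/setP => -[i j]; rewrite !inE /=.
  apply/negP => /andP[h /imsetP[l _ [il jl]]]; move: h.
  by rewrite il jl ltnn !andbF.
have : #|finset.setX I I| = (#|A| + #|B| + #|D|)%N.
  have -> : finset.setX I I = ((A :|: B) :|: D)%SET.
    apply/setP => -[i j]; rewrite !inE /=.
    have -> : ((i, j) \in D) = (i == j) && (i \in I).
      apply/imsetP/andP => [[l lI [-> ->]]|[/eqP -> jI]]; first by rewrite eqxx.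
      by exists j.
    rewrite -val_eqE; case: (ltngtP i j) => ij /=; rewrite ?andbT ?andbF ?orbF //.
    by rewrite (val_inj ij) andbb.
  by rewrite cardsU ABD cards0 subn0 cardsU AD cards0 subn0.
rewrite cardsX AB cD addnn => h.
rewrite bin2 -[LHS]doubleK; congr (_./2).
by apply/eqP; rewrite -(eqn_add2r #|I|) -h; case: #|I| => // x; rewrite -mulnSr.
Qed.

Lemma tauE (k : nat) : tau k = ('C(k, 2) + k)%N.
Proof. by rewrite /tau mulnC -(bin2 k.+1) binS bin1. Qed.

(** * Volume of the matrices with an approximate kernel *)

(** The vectors are rational, so this is a countable union of closed sets; being the
identity on the rows [f] makes them independent. *)
Definition near_kernel (R : realType) (n k : nat) (f : 'I_k -> 'I_n)
    (Z : symmx R n) (eta : R) : set (#|uppair n|.-tuple R) :=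
  [set t | exists V : 'M[rat]_(n, k),
    [/\ forall a b, V (f a) b = (a == b)%:R,
        forall i j, `|ratr (V i j) : R| <= 1 &
        forall j, mxnorm2 ((val (smat t) - val Z) *m col j (map_mx ratr V)) <= eta]].

Lemma measurable_smat_coef (R : realType) (n : nat) (i j : 'I_n) :
  measurable_fun setT (fun t : #|uppair n|.-tuple R => (val (smat t)) i j).
Proof.
have -> : (fun t : #|uppair n|.-tuple R => (val (smat t)) i j) =
    fun t => tnth t (coord_of_entry i j) * (svec_weight R (val i, val j))^-1.
  by apply/funext => t; rewrite /= mxE.
by apply: measurable_funM => //; exact: measurable_tnth.
Qed.

Lemma bigcup_countType_measurable (d : measure_display) (T : measurableType d)
    (I : countType) (F : I -> set T) :
  (forall i, measurable (F i)) -> measurable [set t | exists i, F i t].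
Proof.
move=> mF.
have -> : [set t | exists i, F i t] =
    \bigcup_m (if @unpickle I m is Some i then F i else set0).
  apply/seteqP; split => t /=.
    by move=> [i Fi]; exists (pickle i) => //; rewrite pickleK.
  by move=> [m _]; case: unpickle => // i Fi; exists i.
by apply: bigcupT_measurable => m; case: unpickle.
Qed.

Lemma measurable_forall_ord (d : measure_display) (T : measurableType d)
    (k : nat) (F : 'I_k -> set T) :
  (forall i, measurable (F i)) -> measurable [set t | forall i, F i t].
Proof.
move=> mF; rewrite (_ : [set t | _] = \big[setI/setT]_(i < k) F i).
  by apply: bigsetI_measurable => i _; apply: mF.
apply/seteqP; split => t.
  by move=> h; rewrite -bigcap_seq => i _; apply: h.
by rewrite -bigcap_seq => h i; apply: h => /=; rewrite mem_index_enum.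
Qed.

Lemma measurable_near_kernel (R : realType) (n k : nat) (f : 'I_k -> 'I_n)
    (Z : symmx R n) (eta : R) :
  0 <= eta -> measurable (near_kernel f Z eta).
Proof.
move=> eta0; apply: (@bigcup_countType_measurable _ _ 'M[rat]_(n, k)
  (fun V => [set t | [/\ forall a b, V (f a) b = (a == b)%:R,
        forall i j, `|ratr (V i j) : R| <= 1 &
        forall j, mxnorm2 ((val (smat t) - val Z) *m col j (map_mx ratr V)) <= eta]])).
move=> V.
have [[h1 h2]|h] := pselect ((forall a b, V (f a) b = (a == b)%:R) /\
   (forall i j, `|ratr (V i j) : R| <= 1)); last first.
  rewrite (_ : [set t | _] = set0) //; apply/seteqP; split => t //= [h1 h2 _].
  by case: h.
rewrite (_ : [set t | _] = [set t | forall j : 'I_k,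
  mxnorm2 ((val (smat t) - val Z) *m col j (map_mx ratr V)) <= eta]); last first.
  by apply/seteqP; split => t /= => [[_ _]|h] //; split.
apply: (measurable_forall_ord (F := fun j => [set t |
  mxnorm2 ((val (smat t) - val Z) *m col j (map_mx ratr V)) <= eta])) => j.
under eq_set do rewrite mxnorm2_le //.
apply: measurable_le_cst; apply: measurable_sum => i.
apply: measurable_sum => l.
have mm : measurable_fun setT (fun t : #|uppair n|.-tuple R =>
    ((val (smat t) - val Z) *m col j (map_mx ratr V)) i l).
  have -> : (fun t : #|uppair n|.-tuple R =>
    ((val (smat t) - val Z) *m col j (map_mx ratr V)) i l) =
    fun t => \sum_x ((val (smat t)) i x - (val Z) i x) * ratr (V x j).
    apply/funext => t; rewrite [LHS]mxE; apply: eq_bigr => x _.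
    by rewrite !mxE.
  apply: measurable_sum => x; apply: measurable_funM => //.
  apply: measurable_funB => //; exact: measurable_smat_coef.
exact: measurable_funM.
Qed.

Lemma near_kernel_rigid (R : realType) (n k : nat) (f : 'I_k -> 'I_n)
    (Z : symmx R n) (eta : R) t t' :
  near_kernel f Z eta t -> near_kernel f Z eta t' ->
  (forall i, i \notin block_coords [set f a | a : 'I_k]%SET -> tnth t i = tnth t' i) ->
  forall i, i \in block_coords [set f a | a : 'I_k]%SET ->
  tnth t i - tnth t' i <=
    svec_weight R (val (entry_of_coord i).1, val (entry_of_coord i).2) * (2 * (Num.sqrt n%:R * eta)).
Proof.
move=> [V [Vf V1 tV]] [V' [V'f V'1 t'V']] tt' i.
rewrite inE => /andP[/imsetP[a _ i1] /imsetP[b _ i2]].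
rewrite -(smatK t) -(smatK t') !tnth_svec -mulrBr ler_wpM2l ?(ltW (svec_weight_gt0 _ _)) //.
set M := val (smat t) - val Z; set M' := val (smat t') - val Z.
have -> : (val (smat t)) (entry_of_coord i).1 (entry_of_coord i).2 -
    (val (smat t')) (entry_of_coord i).1 (entry_of_coord i).2 = M (f a) (f b) - M' (f a) (f b).
  by rewrite i1 i2 !mxE; ring.
pose W := map_mx (ratr : rat -> R) V; pose W' := map_mx (ratr : rat -> R) V'.
apply: (@block_rigidity _ _ _ f M M' W W') => //.
- by rewrite linearB /= (symvP _ (subvsP (smat t'))) (symvP _ (subvsP Z)).
- move=> x y; rewrite /M /M' !mxE => h.
  have : coord_of_entry x y \in block_coords [set f a | a : 'I_k]%SET.
    by apply: contraNT h => /tt' ->.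
  rewrite inE coord_of_entryK; case: leqP => _ /= /andP[/imsetP[a' _ ->] /imsetP[b' _ ->]].
    by split; [exists a'|exists b'].
  by split; [exists b'|exists a'].
- by move=> x y; rewrite mxE Vf ratr_nat.
- by move=> x y; rewrite mxE.
- by move=> x y; rewrite mxE V'f ratr_nat.
- by move=> x y; rewrite mxE.
Qed.

Lemma prod_block_weights (R : realType) (n : nat) (I : {set 'I_n}) (l : R) :
  \prod_(i in block_coords I)
    (svec_weight R (val (entry_of_coord i).1, val (entry_of_coord i).2) * l) =
  Num.sqrt 2 ^+ 'C(#|I|, 2) * l ^+ #|block_coords I| /\
  #|block_coords I| = tau #|I|.
Proof.
have diagE : #|[set p : 'I_n * 'I_n | [&& p.1 \in I, p.2 \in I & p.1 == p.2]]%SET| = #|I|.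
  have -> : [set p : 'I_n * 'I_n | [&& p.1 \in I, p.2 \in I & p.1 == p.2]]%SET =
      [set (i, i) | i in I]%SET.
    apply/setP => -[i j]; rewrite inE /=; apply/and3P/imsetP.
      by move=> [iI _ /eqP <-]; exists i.
    by move=> [x xI [-> ->]].
  by rewrite card_imset // => ? ? [].
have predE (p : 'I_n * 'I_n) : ((p.1 \in I) && (p.2 \in I)) && (p.1 <= p.2)%N =
   [&& p.1 \in I, p.2 \in I & p.1 == p.2] || [&& p.1 \in I, p.2 \in I & (p.1 < p.2)%N].
  by rewrite leq_eqVlt val_eqE -andbA -!andb_orr.
split.
  rewrite big_split /= prodr_const; congr (_ * _).
  under eq_bigl do rewrite inE.
  have /= -> := big_uppair *%R (fun p : 'I_n * 'I_n => (p.1 \in I) && (p.2 \in I))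
      (fun p => svec_weight R (val p.1, val p.2)).
  rewrite (bigID (fun p : 'I_n * 'I_n => p.1 == p.2)) /= big1 => [|p /andP[_ /eqP pE]].
    rewrite mul1r -card_offdiag_pairs -prodr_const; apply: eq_big => [p|p].
      by rewrite inE -!andbA ltn_neqAle -val_eqE [(_ != _) && _]andbC.
    by move=> /andP[_ pE]; rewrite /svec_weight /= val_eqE (negbTE pE).
  by rewrite /svec_weight /= pE eqxx.
rewrite tauE -card_offdiag_pairs -diagE -!sum1_card.
under eq_bigl do rewrite inE.
have /= -> := big_uppair addn (fun p : 'I_n * 'I_n => (p.1 \in I) && (p.2 \in I))
      (fun=> 1%N).
rewrite addnC (bigID (fun p : 'I_n * 'I_n => p.1 == p.2)) /=; congr (_ + _)%N.
  apply: eq_bigl => p; rewrite inE -!andbA; case: eqP => [->|]; last by rewrite !andbF.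
  by rewrite leqnn.
apply: eq_bigl => p.
by rewrite inE -!andbA ltn_neqAle -val_eqE [(_ != _) && _]andbC.
Qed.

(** By rigidity the fibers over the entries outside the block of rows and columns
[f] are thin. The factor [n ^ k] prepares the union over all [f]; together with the
weights [sqrt 2] of the [C(k, 2)] off-diagonal coordinates it is absorbed by
[n ^ tau k], because [tau k = C(k, 2) + k]. *)
Lemma near_kernel_measure (R : realType) (n k : nat) (f : 'I_k -> 'I_n)
    (Z : symmx R n) (eta : R) (c : 'I_#|uppair n| -> R) (s : R) :
  (0 < n)%N -> 0 < s -> 0 <= eta ->
  ((n%:R ^+ k * s ^+ tau k)%:E * tuple_measure (near_kernel f Z eta `&` tball c s) <=
   ((n%:R ^+ 2 * (2 * (Num.sqrt n%:R * eta))) ^+ tau k)%:E *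
     tuple_measure (tball c s))%E.
Proof.
move=> n0 s0 eta0; set l := 2 * _.
have l0 : 0 <= l by rewrite !mulr_ge0 ?sqrtr_ge0.
have [fI|nfI] := pselect (injective f); last first.
  have -> : near_kernel f Z eta = set0.
    apply/seteqP; split => t // [V [Vf _ _]]; apply: nfI => a b fab.
    apply/eqP; have := Vf a b; rewrite fab Vf eqxx => /eqP.
    by rewrite eqr_nat; case: (a == b).
  rewrite set0I measure0 mule0; apply: mule_ge0 => //.
  by rewrite lee_fin exprn_ge0 // mulr_ge0 // exprn_ge0.
have cI : #|[set f a | a : 'I_k]%SET| = k by rewrite card_imset // card_ord.
have [prodE cardE] := prod_block_weights [set f a | a : 'I_k]%SET l.
rewrite cI in cardE.
have mA : measurable (near_kernel f Z eta `&` tball c s).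
  by apply: measurableI; [exact: measurable_near_kernel|exact: measurable_tball].
have := thin_fibers_set (card_uppair_gt0 n0) (card_uppair_le n) s0 _ mA (@subIsetr _ _ _)
   (T := block_coords [set f a | a : 'I_k]%SET).
move=> /(_ _ _ (fun t t' At At' tt' => near_kernel_rigid At.1 At'.1 tt')).
rewrite prodE cardE cI => /(_ (fun i => mulr_ge0 (ltW (svec_weight_gt0 _ _)) l0)) h.
rewrite EFinM -muleA.
apply: (le_trans (lee_wpmul2l _ h)); first by rewrite lee_fin exprn_ge0.
rewrite muleA -EFinM; apply: lee_wpmul2r => //; rewrite lee_fin.
have k1 : Num.sqrt 2 ^+ 'C(k, 2) * n%:R ^+ k <= n%:R ^+ tau k :> R.
  rewrite tauE exprD ler_wpM2r ?exprn_ge0 //.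
  have [k2|k2] := leqP k 1; first by rewrite bin_small.
  apply: lerXn2r; rewrite ?nnegrE ?sqrtr_ge0 //.
  have n2 : (2 <= n)%N.
    by apply: leq_trans k2 _; rewrite -(card_ord k) -[n]card_ord; apply: leq_card fI.
  rewrite -(@ler_sqr R) ?nnegrE ?sqrtr_ge0 // sqr_sqrtr // -natrX ler_nat.
  by apply: leq_trans n2 _; rewrite -mulnn leq_pmulr.
apply: (@le_trans _ _ (n%:R ^+ tau k * l ^+ tau k * (Num.sqrt 2 ^+ 'C(k, 2) * n%:R ^+ k))).
  by rewrite le_eqVlt; apply/orP; left; apply/eqP; ring.
apply: (@le_trans _ _ (n%:R ^+ tau k * l ^+ tau k * n%:R ^+ tau k)).
  by apply: ler_wpM2l => //; rewrite mulr_ge0 // exprn_ge0.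
by rewrite [leRHS]exprMn -(exprM _ 2) (mulnC 2) exprM expr2 -mulrA (mulrC (l ^+ _)) mulrA.
Qed.

(** * A net of the range of an adjoint map *)

Section GaugeNet.
Variables (R : realType) (r n : nat) (G : 'I_r -> 'M[R]_n) (X : 'I_r -> 'M[R]_n).
(** [X] is dual to [G], so [G] is free and the coordinates of a combination are
bounded by its norm. *)
Hypothesis GX : forall (t : 'I_r -> R) j, mxdot (\sum_i t i *: G i) (X j) = t j.

Definition gauge (t : 'I_r -> R) : R := mxnorm2 (\sum_i t i *: G i).

Definition gauge_ball (c : 'I_r -> R) (s : R) : set (r.-tuple R) :=
  [set t | gauge (fun i => tnth t i - c i) <= s].

Lemma gauge_ext (t u : 'I_r -> R) : t =1 u -> gauge t = gauge u.
Proof. by move=> tu; rewrite /gauge; congr mxnorm2; apply: eq_bigr => i _; rewrite tu. Qed.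

Lemma gaugeZ (a : R) (t : 'I_r -> R) : gauge (fun i => a * t i) = `|a| * gauge t.
Proof.
rewrite /gauge -mxnorm2Z scaler_sumr; congr mxnorm2.
by apply: eq_bigr => i _; rewrite scalerA.
Qed.

Lemma gaugeD (t u : 'I_r -> R) : gauge (fun i => t i + u i) <= gauge t + gauge u.
Proof.
rewrite /gauge (_ : \sum_i (t i + u i) *: G i = \sum_i t i *: G i + \sum_i u i *: G i).
  exact: mxnorm2D.
by rewrite -big_split; apply: eq_bigr => i _ /=; rewrite scalerDl.
Qed.

Lemma gaugeN (t : 'I_r -> R) : gauge (fun i => - t i) = gauge t.
Proof.
rewrite (@gauge_ext _ (fun i => (-1) * t i)); last by move=> i; rewrite mulN1r.
by rewrite gaugeZ normrN1 mul1r.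
Qed.

Lemma measurable_gauge_ball c s : measurable (gauge_ball c s).
Proof.
have [s0|s0] := leP 0 s; last first.
  rewrite (_ : gauge_ball c s = set0) //; apply/seteqP; split => t //=.
  rewrite /gauge_ball /= => h; have := le_lt_trans h s0.
  by rewrite ltNge mxnorm2_ge0.
rewrite /gauge_ball /gauge; under eq_set do rewrite mxnorm2_le //.
apply: measurable_le_cst; apply: measurable_sum => i.
apply: measurable_sum => l.
have mm : measurable_fun setT (fun t : r.-tuple R =>
    (\sum_j (tnth t j - c j) *: G j) i l).
  have -> : (fun t : r.-tuple R => (\sum_j (tnth t j - c j) *: G j) i l) =
    fun t => \sum_j ((tnth t j - c j) * G j i l).
    by apply/funext => t; rewrite summxE; apply: eq_bigr => j _; rewrite mxE.
  apply: measurable_sum => x; apply: measurable_funM => //.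
  apply: measurable_funB => //; exact: measurable_tnth.
exact: measurable_funM.
Qed.

Local Notation V := (tuple_measure (gauge_ball (fun=> 0) 1)).

Lemma tuple_measure_gauge_ball c s : 0 < s ->
  tuple_measure (gauge_ball c s) = ((s ^+ r)%:E * V)%E.
Proof.
move=> s0; rewrite -(tuple_measure_affine c s0 (measurable_gauge_ball c s)).
congr (_ * tuple_measure _)%E; apply/seteqP.
have E t : gauge (fun i => tnth (affine c s t) i - c i) =
    s * gauge (fun i => tnth t i - 0).
  rewrite -[X in X * _]ger0_norm ?(ltW s0) // -gaugeZ; apply: gauge_ext => i.
  by rewrite /affine tnth_mktuple addrC addKr subr0.
split => t; rewrite /gauge_ball /= E; first by rewrite -[leRHS]mulr1 ler_pM2l.
by move=> h; rewrite -[leRHS]mulr1 ler_pM2l.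
Qed.

Lemma gauge_ball_finite : V \is a fin_num.
Proof.
rewrite ge0_fin_numE //.
pose K := (Num.truncn (\sum_j mxnorm2 (X j))).+1.
apply: le_lt_trans (@tuple_measure_cube R r K).
apply: le_measure; rewrite ?inE; first exact: measurable_gauge_ball.
  by apply: measurable_box.
move=> t; rewrite /gauge_ball /= => h j /=; rewrite in_itv /= -ler_norml.
rewrite -[tnth t j]subr0 -(GX (fun i => tnth t i - 0) j).
apply: le_trans (mxdot_cauchy_abs _ _) _.
apply: (@le_trans _ _ (mxnorm2 (X j))); first by rewrite ler_piMl ?mxnorm2_ge0.
apply: ltW; apply: le_lt_trans (truncnS_gt _).
by rewrite (bigD1 j) //= lerDl; apply: sumr_ge0 => *; apply: mxnorm2_ge0.
Qed.

Lemma gauge_ball_pos : (0 < V)%E.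
Proof.
pose K := \sum_i mxnorm2 (G i) + 1.
have K0 : 0 < K by rewrite ltr_wpDl // sumr_ge0 // => *; exact: mxnorm2_ge0.
pose I : set R := `[- K^-1, K^-1]%classic.
have E := @tuple_measure_box R r (fun=> I) (fun=> measurable_itv _).
apply: (@lt_le_trans _ _ (tuple_measure (box (fun _ : 'I_r => I)))).
  rewrite E (eq_bigr (fun=> (2 * K^-1)%:E)) => [|i _]; last first.
    rewrite /I lebesgue_measure_itv /= lte_fin gtrN ?invr_gt0 //.
    by rewrite -EFinB; congr EFin; ring.
  by rewrite prodEFin lte_fin prodr_gt0 // => i _; rewrite mulr_gt0 // invr_gt0.
apply: le_measure; rewrite ?inE.
- by apply: measurable_box => i; exact: measurable_itv.
- exact: measurable_gauge_ball.
move=> t tI; rewrite /gauge_ball /=.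
have h i : `|tnth t i| <= K^-1 by have := tI i; rewrite /I /= in_itv /= -ler_norml.
apply: (@le_trans _ _ (\sum_i K^-1 * mxnorm2 (G i))).
  rewrite /gauge; elim/big_ind2 : _ => [|a b a' b' h1 h2|i _].
  - by rewrite mxnorm20.
  - by apply: le_trans (mxnorm2D _ _) _; apply: lerD.
  - by rewrite mxnorm2Z subr0 ler_wpM2r ?mxnorm2_ge0.
by rewrite -mulr_sumr mulrC ler_pdivrMr // mul1r lerDl.
Qed.

(** Balls of radius [del / 2] around the points are disjoint and lie in a ball of
radius [kap + del / 2], and volume scales as the [r]-th power of the radius. *)
Lemma separated_card (p : nat) (c : 'I_p -> 'I_r -> R) (kap del : R) :
  0 < del <= kap -> (forall i, gauge (c i) <= kap) ->
  (forall i j, i != j -> del < gauge (fun x => c i x - c j x)) ->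
  p%:R <= (3 * kap / del) ^+ r :> R.
Proof.
move=> /andP[d0 dk] ck cd.
have Vf := gauge_ball_finite; have V0 := gauge_ball_pos.
have d20 : 0 < del / 2 by rewrite divr_gt0.
have dis : trivIset setT (fun i => gauge_ball (c i) (del / 2)).
  apply/trivIsetP => i j _ _ ij; apply/seteqP; split => t //= [hi hj].
  have := cd i j ij; apply/negP; rewrite -leNgt.
  apply: le_trans (_ : del / 2 + del / 2 <= _); last by lra.
  apply: le_trans (lerD hi hj); rewrite addrC -[X in _ <= _ + X]gaugeN.
  rewrite [leLHS](@gauge_ext _ (fun x => (tnth t x - c j x) + - (tnth t x - c i x))).
    exact: gaugeD.
  by move=> x; ring.
have sub : (\big[setU/set0]_(i < p) gauge_ball (c i) (del / 2)) `<=`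
    gauge_ball (fun=> 0) (kap + del / 2).
  move=> t; rewrite -bigcup_seq => -[i _ hi]; rewrite /gauge_ball /=.
  rewrite (@gauge_ext _ (fun x => c i x + (tnth t x - c i x))); last by move=> x; ring.
  by apply: le_trans (gaugeD _ _) _; apply: lerD.
have mU : measurable (\big[setU/set0]_(i < p) gauge_ball (c i) (del / 2)).
  by apply: bigsetU_measurable => i _; exact: measurable_gauge_ball.
have : (tuple_measure (\big[setU/set0]_(i < p) gauge_ball (c i) (del / 2)) <=
   tuple_measure (gauge_ball (fun=> 0%R) (kap + del / 2)%R))%E.
  by apply: le_measure => //; rewrite inE //; exact: measurable_gauge_ball.
have kd0 : 0 < kap + del / 2 by rewrite ltr_wpDr ?(ltW d20) // (lt_le_trans d0).
rewrite (tuple_measure_gauge_ball _ kd0).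
have -> : tuple_measure (\big[setU/set0]_(i < p) gauge_ball (c i) (del / 2)) =
    (\sum_(i < p) tuple_measure (gauge_ball (c i) (del / 2)))%E.
  apply: measure_bigsetU_ord; last exact: dis.
  by move=> i; exact: measurable_gauge_ball.
rewrite (eq_bigr (fun=> ((del / 2) ^+ r)%:E * V)%E) => [|i _]; last first.
  exact: tuple_measure_gauge_ball.
rewrite -(fineK Vf) -!EFinM sumEFin lee_fin sumr_const card_ord -[X in X <= _]mulr_natl mulrA.
have v0 : 0 < fine V by rewrite fine_gt0 // V0 -ge0_fin_numE.
rewrite ler_pM2r // -ler_pdivlMr ?exprn_gt0 // -expr_div_n => h.
apply: le_trans h _; apply: lerXn2r.
- by rewrite nnegrE divr_ge0 // ltW.
- by rewrite nnegrE divr_ge0 ?(ltW d0) // mulr_ge0 // (le_trans (ltW d0)).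
rewrite ler_pdivrMr // (_ : 3 * kap / del * (del / 2) = 3 * kap / 2); first lra.
by field; rewrite lt0r_neq0.
Qed.

(** A maximal separated family is a net. *)
Lemma gauge_net (kap del : R) : 0 < del <= kap ->
  exists (p : nat) (c : 'I_p -> 'I_r -> R),
    p%:R <= (3 * kap / del) ^+ r /\
    forall t, gauge t <= kap -> exists i, gauge (fun x => t x - c i x) <= del.
Proof.
move=> dk.
pose S p := `[< exists c : 'I_p -> 'I_r -> R, (forall i, gauge (c i) <= kap) /\
   (forall i j, i != j -> del < gauge (fun x => c i x - c j x)) >].
have S0 : exists p, S p.
  by exists 0%N; apply/asboolP; exists (fun=> fun=> 0); split => -[].
have Sb p : S p -> (p <= Num.truncn ((3 * kap / del) ^+ r))%N.
  move=> /asboolP[c [ck cd]]; have h := separated_card dk ck cd.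
  by rewrite truncn_ge_nat // (le_trans _ h).
case: (ex_maxnP S0 Sb) => p /asboolP[c [ck cd]] pmax.
exists p, c; split; first exact: separated_card dk ck cd.
move=> t tk; apply: contrapT => nt.
have far i : del < gauge (fun x => t x - c i x).
  by rewrite ltNge; apply/negP => h; apply: nt; exists i.
suff : S p.+1 by move=> /pmax; rewrite ltnn.
apply/asboolP; exists (fun i => if unlift ord0 i is Some j then c j else t).
split=> [i|i j].
  by case: unliftP => [i' _|_].
case: unliftP => [i' ->|->]; case: unliftP => [j' ->|->] ij.
- by apply: cd; apply: contra ij => /eqP ->.
- rewrite -gaugeN (@gauge_ext _ (fun x => t x - c i' x)); first exact: far.
  by move=> x; ring.
- exact: far.
- by rewrite eqxx in ij.
Qed.
End GaugeNet.

(** The adjoint pairs with [Y] through [A Y], which has only [dim (limg A)]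
coordinates in a basis of the range; [G i] represents the [i]-th of them and [X j]
is mapped by [A] to the [j]-th basis vector. *)
Lemma adjmap_coordinates (R : realType) (n m : nat)
    (A : 'Hom(symmx R n, 'cV[R]_m)) :
  exists G X : 'I_(maprank A) -> symmx R n,
    (forall t j, mxdot (\sum_i t i *: val (G i)) (val (X j)) = t j) /\
    (forall l, exists t, val (adjmap A l) = \sum_i t i *: val (G i)).
Proof.
pose E := vbasis (limg A).
have bE : basis_of (limg A) E := vbasisP (limg A).
have hX (j : 'I_(maprank A)) : {X : symmx R n | A X = E`_j}.
  apply: cid; have : E`_j \in limg A.
    by apply: vbasis_mem; apply: mem_nth; rewrite size_tuple.
  by move=> /memv_imgP[X _ ->]; exists X.
pose l i : 'cV[R]_m := \col_j coord E i (delta_mx j 0).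
have lE i v : mxdot (l i) v = coord E i v.
  rewrite [in RHS](matrix_sum_delta v) linear_sum; apply: eq_bigr => j _.
  by rewrite !big_ord1 linearZ mxE /= mulrC.
exists (fun i => adjmap A (l i)), (fun j : 'I_(maprank A) => sval (hX j)).
have dotG i Y : mxdot (val (adjmap A (l i))) (val Y) = coord E i (A Y).
  by rewrite -adjmapP lE.
have dotS (t : 'I_(maprank A) -> R) Y :
    mxdot (\sum_i t i *: val (adjmap A (l i))) (val Y) = \sum_i t i * coord E i (A Y).
  rewrite mxdotC linear_sum; apply: eq_bigr => i _.
  by rewrite linearZ /= mxdotC dotG.
split=> [t j|w].
  rewrite dotS (svalP (hX j)) (bigD1 j) //= coord_free ?(basis_free bE) // eqxx mulr1.
  rewrite big1 ?addr0 // => i ij.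
  by rewrite coord_free ?(basis_free bE) // eq_sym (negbTE ij) mulr0.
exists (fun i : 'I_(maprank A) => mxdot w E`_i).
pose D := adjmap A w - \sum_(i < maprank A) mxdot w E`_i *: adjmap A (l i).
have valD : val D = val (adjmap A w) -
    \sum_(i < maprank A) mxdot w E`_i *: val (adjmap A (l i)).
  by rewrite /D linearB linear_sum; congr (_ - _); apply: eq_bigr => i _; rewrite linearZ.
apply/eqP; rewrite -subr_eq0 -valD; apply/eqP/mxnorm2_eq0.
rewrite /mxnorm2 {1}valD mxdotDl mxdotNl dotS -adjmapP.
have AD : A D = \sum_(i < maprank A) coord E i (A D) *: E`_i.
  by apply: (coord_basis bE); apply: memv_img; exact: memvf.
rewrite {1}AD linear_sum -sumrB big1 ?sqrtr0 // => i _.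
by rewrite linearZ /= mulrC subrr.
Qed.

Lemma adjmap_net (R : realType) (n m : nat) (A : 'Hom(symmx R n, 'cV[R]_m))
    (kap del : R) : 0 < del <= kap ->
  exists (p : nat) (Z : 'I_p -> symmx R n),
    p%:R <= (3 * kap / del) ^+ maprank A /\
    forall l, mxnorm2 (val (adjmap A l)) <= kap ->
      exists i, mxnorm2 (val (adjmap A l) - val (Z i)) <= del.
Proof.
move=> dk; have [G [X [GX Al]]] := adjmap_coordinates A.
have [p [c [pk net]]] := gauge_net GX dk.
exists p, (fun i => \sum_x c i x *: G x); split => // l lk.
have [t tE] := Al l.
have [|i hi] := net t; first by rewrite /gauge -tE.
exists i; apply: le_trans hi; rewrite /gauge tE le_eqVlt; apply/orP; left; apply/eqP.
have -> : val (\sum_x c i x *: G x) = \sum_x c i x *: val (G x).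
  by rewrite linear_sum; apply: eq_bigr => x _; rewrite linearZ.
by rewrite -sumrB; congr mxnorm2; apply: eq_bigr => x _; rewrite scalerBl.
Qed.

(** * Probability of a degenerate block *)

Lemma opnorm_bounded (R : realType) (n m : nat) (A : 'Hom(symmx R n, 'cV[R]_m)) :
  exists K : R, 0 <= K /\ forall X, mxnorm2 (A X) <= K * mxnorm2 (val X).
Proof.
pose K := \sum_i \sum_j mxnorm2 (A (sympart (delta_mx i j))).
exists K; split.
  by apply: sumr_ge0 => i _; apply: sumr_ge0 => j _; exact: mxnorm2_ge0.
move=> X; rewrite -{1}[X]sympartK {1}[val X]matrix_sum_delta !linear_sum mulr_suml.
elim/big_ind2 : _ => [|a b a' b' h1 h2|i _]; first by rewrite mxnorm20.
  by apply: le_trans (mxnorm2D _ _) _; apply: lerD.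
rewrite !linear_sum mulr_suml.
elim/big_ind2 : _ => [|a b a' b' h1 h2|j _]; first by rewrite mxnorm20.
  by apply: le_trans (mxnorm2D _ _) _; apply: lerD.
by rewrite !linearZ /= mxnorm2Z mulrC ler_wpM2l ?mxnorm2_ge0 // mxnorm2_coef.
Qed.

Lemma mxnorm2_opnormF2 (R : realType) (n m : nat) (A : 'Hom(symmx R n, 'cV[R]_m))
    (X : symmx R n) :
  mxnorm2 (A X) <= opnormF2 A * mxnorm2 (val X).
Proof.
have [K [K0 AK]] := opnorm_bounded A.
have [X0|X0] := eqVneq (val X) 0.
  have -> : X = 0 by apply: val_inj.
  by rewrite linear0 !mxnorm20 mulr0.
have x0 := mxnorm2_gt0 X0.
have ubS : has_ubound [set mxnorm2 (A Y) | Y in [set Y : symmx R n | mxnorm2 (val Y) <= 1]].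
  exists K => _ [Y /= Y1 <-]; apply: le_trans (AK Y) _.
  by rewrite ler_piMr.
rewrite -ler_pdivrMr //.
apply: (ub_le_sup ubS); exists ((mxnorm2 (val X))^-1 *: X).
  change (mxnorm2 ((mxnorm2 (val X))^-1 *: val X) <= 1).
  rewrite mxnorm2Z ger0_norm ?invr_ge0 ?mxnorm2_ge0 // mulVf ?lt0r_neq0 //.
by rewrite linearZ /= mxnorm2Z ger0_norm ?invr_ge0 ?mxnorm2_ge0 // mulrC.
Qed.

Lemma opnormF2_ge0 (R : realType) (n m : nat) (A : 'Hom(symmx R n, 'cV[R]_m)) :
  0 <= opnormF2 A.
Proof.
have [K [K0 AK]] := opnorm_bounded A.
apply: ub_le_sup.
  exists K => _ [Y /= Y1 <-]; apply: le_trans (AK Y) _.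
  by rewrite ler_piMr.
by exists 0; rewrite /= ?linear0 mxnorm20.
Qed.

Lemma mxnorm2_adjmap (R : realType) (n m : nat) (A : 'Hom(symmx R n, 'cV[R]_m))
    (l : 'cV[R]_m) :
  mxnorm2 (val (adjmap A l)) <= opnormF2 A * mxnorm2 l.
Proof.
set Y := adjmap A l.
have [Y0|Y0] := eqVneq (val Y) 0.
  by rewrite Y0 mxnorm20 mulr_ge0 ?opnormF2_ge0 ?mxnorm2_ge0.
have y0 := mxnorm2_gt0 Y0.
rewrite -(ler_pM2r y0) -expr2 sqr_mxnorm2 -adjmapP.
apply: le_trans (mxdot_cauchy _ _) _.
by rewrite -mulrA mulrCA ler_wpM2l ?mxnorm2_ge0 // mxnorm2_opnormF2.
Qed.

Lemma measure_bigsetU_le (R : realType) (d : measure_display)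
    (T : measurableType d) (P : {measure set T -> \bar R}) (I : finType)
    (E : I -> set T) (q : I -> R) :
  (forall i, measurable (E i)) -> (forall i, P (E i) <= (q i)%:E)%E ->
  (P (\big[setU/set0]_i E i) <= (\sum_i q i)%:E)%E.
Proof.
move=> mE Eq; rewrite -sumEFin.
suff [] : measurable (\big[setU/set0]_i E i) /\
   (P (\big[setU/set0]_i E i) <= \sum_i (q i)%:E)%E by [].
elim/big_ind2 : _ => [|A a B b [mA Aa] [mB Bb]|i _]; last by split.
  by rewrite measure0.
split; first exact: measurableU.
by apply: le_trans (measureU2 _ mA mB) _; apply: leeD.
Qed.

Lemma near_kernel_perturb (R : realType) (n : nat) (S T : 'M[R]_n) (v : 'cV[R]_n)
    (del s : R) :
  mxnorm2 (S *m v) <= del * mxnorm2 v -> mxnorm2 T <= del -> mxnorm2 v <= s ->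
  0 < del -> mxnorm2 ((S + T) *m v) <= 2 * del * s.
Proof.
move=> Sv Tdel vs d0; rewrite mulmxDl; apply: le_trans (mxnorm2D _ _) _.
have h1 : del * mxnorm2 v <= del * s by rewrite ler_pM2l.
have h2 : mxnorm2 (T *m v) <= del * s.
  apply: le_trans (mxnorm2_mulv _ _) _.
  by apply: ler_pM; rewrite ?mxnorm2_ge0.
lra.
Qed.

(** The constants of the union bound: [q] stands for [sqrt n], and [x ^ t = e] pays
for the tolerance that is enlarged to reach rational vectors. *)
Lemma union_constant (R : realType) (N q del sigma x e p K : R) (k t : nat) :
  0 < N -> q ^+ 2 = N -> 0 < del -> 0 < sigma -> x ^+ t = e -> 0 <= e -> p <= K ->
  p * N ^+ k * (((N ^+ 2 * (2 * (q * (2 * del * q * x)))) / sigma) ^+ t / N ^+ k) <=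
  e * K * (4 * N ^+ 3 * del / sigma) ^+ t.
Proof.
move=> N0 qN d0 s0 xt e0 pK.
have -> : N ^+ 2 * (2 * (q * (2 * del * q * x))) / sigma = 4 * N ^+ 3 * del / sigma * x.
  by rewrite -qN; field; exact: lt0r_neq0.
set b := 4 * N ^+ 3 * del / sigma.
have b0 : 0 <= b by rewrite divr_ge0 ?(ltW s0) // !mulr_ge0 ?(ltW d0) ?exprn_ge0 ?(ltW N0).
rewrite exprMn xt.
have -> : p * N ^+ k * (b ^+ t * e / N ^+ k) = p * (e * b ^+ t).
  by field; rewrite lt0r_neq0 // exprn_gt0.
rewrite -[leRHS]mulrA [leRHS]mulrCA ler_wpM2r // mulr_ge0 // exprn_ge0 //.
Qed.

Lemma kernel_vector (R : fieldType) (n k : nat) (F : 'M[R]_(n, k)) :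
  ~~ row_full F -> exists2 v : 'cV[R]_k, v != 0 & F *m v = 0.
Proof.
rewrite /row_full -mxrank_tr -/(row_free _) -kermx_eq0 => /rowV0Pn[u /sub_kermxP uF u0].
exists u^T; first by rewrite trmx_eq0.
by apply: trmx_inj; rewrite trmx_mul trmxK uF trmx0.
Qed.

Section UniformBlock.
Variables (R : realType) (d : measure_display) (Omega : measurableType d)
  (P : probability Omega R) (n : nat) (C : Omega -> symmx R n) (Cbar : symmx R n)
  (sigma : R).
Hypotheses (n_gt0 : (0 < n)%N) (sigma_gt0 : 0 < sigma)
  (C_uniform : uniform_frob_ball P C Cbar sigma).

Local Notation c := (fun t => tnth (svec Cbar) t).

Lemma measurable_event (B : set (#|uppair n|.-tuple R)) :
  measurable B -> measurable [set w | B (svec (C w))].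
Proof. by move=> mB; have := C_uniform.1 measurableT B mB; rewrite setTI. Qed.

Lemma uniformE (B : set (#|uppair n|.-tuple R)) : measurable B ->
  P [set w | B (svec (C w))] =
  (tuple_measure (B `&` tball c sigma) *
    ((fine (tuple_measure (tball c sigma)))^-1)%:E)%E.
Proof.
move=> mB; have mK := measurable_tball c sigma.
rewrite C_uniform.2 // svec_frob_ball ?(ltW sigma_gt0) //.
have -> := tuple_measureE mK.
by have -> := tuple_measureE (measurableI _ _ mB mK).
Qed.

(** Otherwise the uniform law would have total mass zero. *)
Lemma ball_measure_gt0 : 0 < fine (tuple_measure (tball c sigma)).
Proof.
rewrite lt_neqAle fine_ge0 ?measure_ge0 // andbT; apply/eqP => K0.
have := @uniformE setT measurableT; rewrite -K0 invr0 mule0.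
rewrite (_ : [set w | _] = setT); last by apply/seteqP.
by rewrite probability_setT => /eqP; rewrite onee_eq0.
Qed.

Lemma outside_ball_null :
  P [set w | ~ (mxnorm2 (val (C w) - val Cbar) <= sigma)] = 0%E.
Proof.
have mK := measurable_tball c sigma.
have := uniformE (measurableC mK).
rewrite setICl measure0 mul0e => <-; congr (P _); apply/seteqP.
by split => w /=; rewrite /tball /= svec_isometry ler_sqr ?nnegrE ?mxnorm2_ge0
  ?(ltW sigma_gt0).
Qed.

Lemma near_kernel_prob (k : nat) (f : 'I_k -> 'I_n) (Z : symmx R n) (eta : R) :
  0 <= eta ->
  (P [set w | near_kernel f Z eta (svec (C w))] <=
   (((n%:R ^+ 2 * (2 * (Num.sqrt n%:R * eta))) / sigma) ^+ tau k / n%:R ^+ k)%:E)%E.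
Proof.
move=> eta0; rewrite uniformE; last exact: measurable_near_kernel.
have := near_kernel_measure f Z c n_gt0 sigma_gt0 eta0.
have v0 := ball_measure_gt0; set v := fine _ in v0 *.
have KE : tuple_measure (tball c sigma) = v%:E.
  rewrite /v fineK // tuple_measure_tball // fin_numM //.
  exact: tuple_measure_unit_tball.
have mA : measurable (near_kernel f Z eta `&` tball c sigma).
  by apply: measurableI; [exact: measurable_near_kernel|exact: measurable_tball].
have : tuple_measure (near_kernel f Z eta `&` tball c sigma) \is a fin_num.
  rewrite ge0_fin_numE //; apply: le_lt_trans (ltry v); rewrite -KE.
  by apply: le_measure; rewrite ?inE //; exact: measurable_tball.
rewrite KE => /fineK <-; set u := fine _; rewrite -!EFinM !lee_fin => h.
have nk0 : 0 < n%:R ^+ k :> R by rewrite exprn_gt0 // ltr0n.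
have st0 : 0 < sigma ^+ tau k by rewrite exprn_gt0.
rewrite ler_pdivrMr // mulrAC ler_pdivlMr // expr_div_n mulrAC ler_pdivlMr //.
by apply: le_trans h; rewrite le_eqVlt; apply/orP; left; apply/eqP; ring.
Qed.

(** Normalize [F] on a maximal minor: the slack nearly annihilates the normalized
columns, whose norms are at most [sqrt n]. Moving [adjmap A l] to the nearest point
of the net costs as much again. There are [p * n ^ k] sets in the union. *)
Lemma bad_block (m k : nat) (A : 'Hom(symmx R n, 'cV[R]_m)) (kap del : R) :
  (0 < k)%N -> 0 < del <= kap ->
  exists B : set Omega,
    [/\ measurable B,
       (P B <= (expR 1 * (3 * kap / del) ^+ maprank A *
                (4 * n%:R ^+ 3 * del / sigma) ^+ tau k)%:E)%E &
       forall w l (F : 'M[R]_(n, k)) (g : R), 0 < g ->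
         mxnorm2 (val (adjmap A l)) <= kap ->
         (forall v : 'cV[R]_k, g * mxnorm2 v <= mxnorm2 (F *m v)) ->
         mxnorm2 (slack A (C w) l *m F) <= del * g -> B w].
Proof.
move=> k0 dk; have /andP[d0 _] := dk.
have [p [Z [pk net]]] := adjmap_net A dk.
have t0 : (0 < tau k)%N by rewrite tauE addn_gt0 k0 orbT.
(* [x > 1] is the room for rational approximation, and [x ^ tau k] is only [e]. *)
pose x := expR ((tau k)%:R^-1) : R.
have x1 : 1 < x by rewrite expR_gt1 invr_gt0 ltr0n.
have xt : x ^+ tau k = expR 1.
  by rewrite /x -expRM_natl mulfV // pnatr_eq0 -lt0n.
have sn0 : 0 < Num.sqrt n%:R :> R by rewrite sqrtr_gt0 ltr0n.
pose eta := 2 * del * Num.sqrt n%:R.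
have eta0 : 0 < eta by rewrite !mulr_gt0.
pose I : finType := ('I_p * {ffun 'I_k -> 'I_n})%type.
pose E (i : I) := [set w | near_kernel i.2 (Z i.1) (eta * x) (svec (C w))].
have etax0 : 0 <= eta * x by rewrite mulr_ge0 ?(ltW eta0) // (le_trans ler01) // ltW.
have mE i : measurable (E i).
  by apply: measurable_event; exact: measurable_near_kernel.
exists (\big[setU/set0]_i E i); split.
- by apply: bigsetU_measurable => i _.
- apply: le_trans (measure_bigsetU_le mE (fun i => near_kernel_prob i.2 (Z i.1) etax0)) _.
  rewrite lee_fin sumr_const -[X in X <= _]mulr_natl card_prod card_ffun !card_ord natrM natrX.
  by apply: union_constant; rewrite ?sqr_sqrtr // ltr0n.
move=> w l F g g0 lk Fg SF.
have fullF : row_full F.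
  apply: contraT => /kernel_vector[v v0 Fv]; have := Fg v; rewrite Fv mxnorm20.
  by rewrite leNgt mulr_gt0 // mxnorm2_gt0.
have [f [U [Wf W1]]] := maximal_minor_basis fullF.
have [i Zi] := net l lk.
have SW j : mxnorm2 ((val (C w) - val (Z i)) *m col j (F *m U)) <= eta.
  have -> : val (C w) - val (Z i) = slack A (C w) l + (val (adjmap A l) - val (Z i)).
    by rewrite /slack addrA subrK.
  apply: near_kernel_perturb => //; last first.
    by rewrite -[leRHS]mulr1; apply: mxnorm2_le_sqrt => // x'; rewrite mxE.
  have -> : col j (F *m U) = F *m col j U by rewrite colE -mulmxA -colE.
  rewrite mulmxA; apply: le_trans (mxnorm2_mulv _ _) _.
  apply: le_trans (ler_wpM2r (mxnorm2_ge0 _) SF) _.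
  by rewrite -mulrA ler_pM2l.
have ee : eta < eta * x by rewrite ltr_pMr.
have [V [Vf V1 VM]] := rat_near_kernel Wf W1 SW ee.
rewrite -bigcup_seq; exists (i, f); first by rewrite /= mem_index_enum.
by exists V; split => // j; rewrite svecK.
Qed.
End UniformBlock.

(** * The smallest eigenvalue bounds the quadratic form *)

Lemma continuous_sum (R : realType) (T : topologicalType) (k : nat)
    (F : 'I_k -> T -> R) :
  (forall i, continuous (F i)) -> continuous (fun x => \sum_i F i x).
Proof. by move=> cF; apply: continuous_big => //; exact: add_continuous. Qed.

Lemma mxdot_continuous (R : realType) (N : nat) (M : 'M[R]_N) :
  continuous (fun v : 'rV[R]_N => mxdot (v *m M) v).
Proof.
have cM i j : continuous (fun v : 'rV[R]_N => (v *m M) i j).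
  have -> : (fun v : 'rV[R]_N => (v *m M) i j) = fun v => \sum_l v i l * M l j.
    by apply/funext => x; rewrite mxE.
  apply: continuous_sum => l x.
  have := @coord_continuous R 1 N i l x. move=> h.
  exact: (cvgM h (cvg_cst (M l j))).
apply: continuous_sum => i; apply: continuous_sum => j v.
exact: (cvgM (cM i j v) (@coord_continuous R 1 N i j v)).
Qed.

(** The minimum over the unit sphere is attained (compactness) and a minimizer is an
eigenvector, because a positive semidefinite form vanishes only on its kernel. *)
Lemma lambda_min_rayleigh (R : realType) (N : nat) (M : 'M[R]_N) (v : 'rV[R]_N) :
  M^T = M -> lambda_min M * mxdot v v <= mxdot (v *m M) v.
Proof.
move=> MT; have [->|v0] := eqVneq v 0; first by rewrite !linear0 mulr0.
pose S : set 'rV[R]_N := [set u | mxdot u u = 1].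
have unitS (u : 'rV[R]_N) : u != 0 -> S ((mxnorm2 u)^-1 *: u).
  move=> u0; rewrite /S /= mxdotZl mxdotZr mulrA -sqr_mxnorm2 -expr2 -exprMn.
  by rewrite mulVf ?expr1n // lt0r_neq0 // mxnorm2_gt0.
have cS : compact S.
  have cI : compact [set u : 'rV[R]_N | forall i, u ord0 i \in `[(-1), 1]].
    exact: (@rV_compact R N (fun=> `[(-1), 1]%classic) (fun=> @segment_compact _ _ _)).
  apply: subclosed_compact _ cI _.
  - have -> : S = (fun u : 'rV[R]_N => mxdot u u) @^-1` [set x : R | x = 1] by [].
    apply: closed_comp => [u _|]; last exact: closed_eq.
    have := @mxdot_continuous R N 1%:M u.
    have -> : (fun v : 'rV[R]_N => mxdot (v *m 1%:M) v) = fun u => mxdot u u.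
      by apply/funext => w; rewrite mulmx1.
    exact.
  move=> u; rewrite /S /= => u1 i; rewrite in_itv /= -ler_norml.
  by apply: le_trans (mxnorm2_coef _ _ _) _; rewrite /mxnorm2 u1 sqrtr1.
have [||u Su umin] := @EVT_min_rV R N (fun u => mxdot (u *m M) u) S _ cS.
- by exists ((mxnorm2 v)^-1 *: v); exact: unitS.
- by apply: continuous_subspaceT; exact: mxdot_continuous.
set mu := mxdot (u *m M) u in umin.
have low (w : 'rV[R]_N) : mu * mxdot w w <= mxdot (w *m M) w.
  have [->|w0] := eqVneq w 0; first by rewrite !linear0 mulr0.
  have nw := mxnorm2_gt0 w0.
  have := umin _ (mem_set (unitS w w0)).
  rewrite -scalemxAl mxdotZl mxdotZr mulrA -expr2 -sqr_mxnorm2 exprVn mulrC.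
  by rewrite ler_pdivlMr ?exprn_gt0.
have eig : u *m M = mu *: u.
  apply/eqP; rewrite -subr_eq0; apply/eqP/mxnorm2_eq0.
  set z := u *m M - mu *: u.
  have dz (w : 'rV[R]_N) : mxdot w z = mxdot (w *m M) u - mu * mxdot w u.
    by rewrite /z mxdotDr mxdotNr mxdotZr mxdotC mxdot_mulr MT mxdotC.
  clearbody z.
  pose B := mxdot (z *m M) z - mu * mxdot z z.
  have quad t : 0 <= 2 * t * mxdot z z + t ^+ 2 * B.
    have := low (u + t *: z).
    rewrite mulmxDl -scalemxAl !mxdotDl !mxdotDr !mxdotZl !mxdotZr -/mu.
    have -> : mxdot u u = 1 by move: Su; rewrite inE.
    rewrite (_ : mxdot (u *m M) z = mxdot (z *m M) u); last by rewrite mxdot_mulr MT mxdotC.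
    rewrite (mxdotC u z).
    have d1 := dz z; rewrite /B; set a := mxdot (z *m M) z; set e := mxdot z z in d1 *.
    set f := mxdot (z *m M) u in d1 *; set g := mxdot z u in d1 *.
    have fE : f = e + mu * g by rewrite d1; ring.
    rewrite fE -subr_ge0 => h; apply: le_trans h _.
    by rewrite le_eqVlt; apply/orP; left; apply/eqP; ring.
  apply/eqP; rewrite /mxnorm2 sqrtr_eq0 leNgt; apply/negP => z0.
  set e := mxdot z z in quad z0.
  have B0 : 0 < `|B| + 1 by rewrite ltr_wpDl.
  have t0 : 0 < e / (`|B| + 1) by rewrite divr_gt0.
  have := quad (- (e / (`|B| + 1))).
  have -> : 2 * - (e / (`|B| + 1)) * e + (- (e / (`|B| + 1))) ^+ 2 * B =
    - (e / (`|B| + 1)) * (2 * e - e / (`|B| + 1) * B) by ring.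
  rewrite mulNr oppr_ge0 pmulr_rle0 // subr_le0 => h.
  have : e / (`|B| + 1) * B <= e.
    rewrite mulrAC ler_pdivrMr // ler_pM2l //.
    by apply: le_trans (ler_norm B) _; rewrite lerDl.
  move=> h2; have := le_trans h h2; rewrite leNgt => /negP; apply; lra.
have u0 : u != 0.
  apply/eqP => u0; move: Su; rewrite inE /S /= u0 linear0 => /esym/eqP.
  by rewrite oner_eq0.
have muE : eigenvalue M mu by apply/eigenvalueP; exists u.
apply: le_trans (low v); apply: ler_wpM2r; first exact: mxdot_ge0.
apply: ge_inf => //; exists mu => a /eigenvalueP[w wa w0].
have nw : 0 < mxdot w w by rewrite -sqr_mxnorm2 exprn_gt0 // mxnorm2_gt0.
by have := low w; rewrite wa mxdotZl ler_pM2r.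
Qed.

(** * Derivatives of the augmented Lagrangian *)

Lemma derive_polynomial (R : realType) (N : nat) (f : 'rV[R]_N -> R)
    (x v : 'rV[R]_N) (l a b c : R) :
  (forall h, f (h *: v + x) =
     f x + (h * l + (h ^+ 2 * a + (h ^+ 3 * b + h ^+ 4 * c)))) ->
  'D_v f x = l.
Proof.
move=> fE; rewrite /derive; apply: cvg_lim => //.
pose g (h : R) : R := l + h * (a + h * (b + h * c)).
have gl : g @ (0 : R) --> l.
  have -> : l = l + 0 * (a + 0 * (b + 0 * c)) by rewrite mul0r addr0.
  apply: cvgD; first exact: cvg_cst.
  apply: cvgM; first exact: cvg_id.
  apply: cvgD; first exact: cvg_cst.
  apply: cvgM; first exact: cvg_id.
  apply: cvgD; first exact: cvg_cst.
  apply: cvgM; [exact: cvg_id|exact: cvg_cst].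
have gl' : g @ (0 : R)^' --> l by apply: cvg_trans gl; apply: cvg_app; exact: nbhs_dnbhs.
apply: cvg_trans gl'; apply: near_eq_cvg.
near=> h; have h0 : h != 0 by near: h; exact: nbhs_dnbhs_neq.
rewrite /= fE /g; change (l + h * (a + h * (b + h * c)) =
  h^-1 * (f x + (h * l + (h ^+ 2 * a + (h ^+ 3 * b + h ^+ 4 * c))) - f x)).
by field.
Unshelve. all: by end_near.
Qed.

Lemma symvalD (R : realType) (n : nat) (X Y : symmx R n) :
  val (X + Y) = val X + val Y.
Proof. by []. Qed.

Lemma symvalZ (R : realType) (n : nat) (a : R) (X : symmx R n) :
  val (a *: X) = a *: val X.
Proof. by []. Qed.

Lemma trmx_linear (R : realType) (p r : nat) (h : R) (U V : 'M[R]_(p, r)) :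
  (h *: U + V)^T = h *: U^T + V^T.
Proof. by rewrite linearD linearZ. Qed.

Lemma symcross_subproof (R : realType) (n k : nat) (F V : 'M[R]_(n, k)) :
  F *m V^T + V *m F^T \in symv R n.
Proof. by apply/symvP; rewrite linearD /= !trmx_mul !trmxK addrC. Qed.

(** The differential of [gram] at [F] in the direction [V]. *)
Definition symcross (R : realType) (n k : nat) (F V : 'M[R]_(n, k)) : symmx R n :=
  Subvs (symcross_subproof F V).

Lemma symcrossE (R : realType) (n k : nat) (F V : 'M[R]_(n, k)) :
  val (symcross F V) = F *m V^T + V *m F^T.
Proof. by []. Qed.

Lemma symcrossC (R : realType) (n k : nat) (F V : 'M[R]_(n, k)) :
  symcross F V = symcross V F.
Proof. by apply: val_inj; rewrite !symcrossE addrC. Qed.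

Lemma symcross_linear (R : realType) (n k : nat) (F U V : 'M[R]_(n, k)) (h : R) :
  symcross F (h *: U + V) = h *: symcross F U + symcross F V.
Proof.
apply: val_inj; rewrite [LHS]symcrossE symvalD (symvalZ h) !symcrossE.
rewrite trmx_linear mulmxDr mulmxDl.
by rewrite -scalemxAr -scalemxAl scalerDr addrACA.
Qed.

Lemma gram_expand (R : realType) (n k : nat) (F V : 'M[R]_(n, k)) (h : R) :
  gram (h *: V + F) = gram F + (h *: symcross F V + h ^+ 2 *: gram V).
Proof.
have gramE (G : 'M[R]_(n, k)) : val (gram G) = G *m G^T by [].
apply: val_inj; rewrite [LHS]gramE !symvalD (symvalZ h) (symvalZ (h ^+ 2)) symcrossE !gramE.
rewrite trmx_linear mulmxDr !mulmxDl.
rewrite -!scalemxAl -!scalemxAr scalerA -expr2 scalerDr.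
by rewrite [RHS]addrC addrA; congr (_ + _); rewrite [RHS]addrC addrA.
Qed.

Section Derivatives.
Variables (R : realType) (q m : nat) (n k : 'I_q -> nat).
Variables (A : forall c, 'Hom(symmx R (n c), 'cV[R]_m)) (b : 'cV[R]_m).
Variables (C : forall c, symmx R (n c)) (rho : R) (y : 'cV[R]_m).
Local Notation factors := (factors R n k).

Definition fadd (h : R) (V F : factors) : factors := fun c => h *: V c + F c.

Definition cross_constr (F V : factors) : 'cV[R]_m := \sum_c A c (symcross (F c) (V c)).

Definition gram_constr (V : factors) : 'cV[R]_m := \sum_c A c (gram (V c)).

Lemma constr_expand (F V : factors) (h : R) :
  constr A b (fadd h V F) =
  constr A b F + (h *: cross_constr F V + h ^+ 2 *: gram_constr V).
Proof.
rewrite /constr /cross_constr /gram_constr !scaler_sumr addrAC -!big_split.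
congr (_ - b); apply: eq_bigr => c _ /=.
by rewrite /fadd gram_expand !linearD !linearZ.
Qed.

Definition multiplier (F : factors) : 'cV[R]_m := y - rho *: constr A b F.

Definition dPhi (F V : factors) : R :=
  \sum_c mxdot (val (C c)) (val (symcross (F c) (V c)))
  - mxdot (multiplier F) (cross_constr F V).

Definition d2Phi (F U V : factors) : R :=
  \sum_c mxdot (val (C c)) (val (symcross (U c) (V c)))
  - mxdot (multiplier F) (cross_constr U V)
  + rho * mxdot (cross_constr F U) (cross_constr F V).

(** Along a line the function is a polynomial of degree four, so its directional
derivatives are read off from its coefficients. *)
Lemma Phi_expand (F V : factors) :
  exists u v w, forall h, Phi A b C rho y (fadd h V F) =
    Phi A b C rho y F +
    (h * dPhi F V + (h ^+ 2 * u + (h ^+ 3 * v + h ^+ 4 * w))).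
Proof.
pose costs := \sum_c mxdot (val (C c)) (val (gram (V c))).
exists (costs - mxdot y (gram_constr V) + rho / 2 *
    (2 * mxdot (constr A b F) (gram_constr V) +
     mxdot (cross_constr F V) (cross_constr F V))),
  (rho * mxdot (cross_constr F V) (gram_constr V)),
  (rho / 2 * mxdot (gram_constr V) (gram_constr V)) => h.
rewrite /Phi /dPhi /multiplier constr_expand !sqr_mxnorm2.
have -> : \sum_c mxdot (val (C c)) (fadd h V F c *m (fadd h V F c)^T) =
    \sum_c mxdot (val (C c)) (F c *m (F c)^T) +
    h * (\sum_c mxdot (val (C c)) (val (symcross (F c) (V c)))) + h ^+ 2 * costs.
  have E c : mxdot (val (C c)) (fadd h V F c *m (fadd h V F c)^T) =
      mxdot (val (C c)) (F c *m (F c)^T) +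
      h * mxdot (val (C c)) (val (symcross (F c) (V c))) +
      h ^+ 2 * mxdot (val (C c)) (val (gram (V c))).
    change (fadd h V F c *m (fadd h V F c)^T) with (val (gram (h *: V c + F c))).
    by rewrite gram_expand !symvalD (symvalZ h) (symvalZ (h ^+ 2)) 2!mxdotDr 2!mxdotZr addrA.
  by rewrite (eq_bigr _ (fun c _ => E c)) !big_split /= !mulr_sumr.
move: (constr A b F) (cross_constr F V) (gram_constr V) => u v w.
rewrite !mxdotDl !mxdotDr !mxdotNl !mxdotZl !mxdotZr.
by rewrite (mxdotC v u) (mxdotC w u) (mxdotC w v); field.
Qed.

Lemma cross_constr_linear (F U V : factors) (h : R) :
  cross_constr F (fadd h U V) = h *: cross_constr F U + cross_constr F V.
Proof.
rewrite /cross_constr scaler_sumr -big_split; apply: eq_bigr => c _ /=.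
by rewrite /fadd symcross_linear linearD linearZ.
Qed.

Lemma cross_constrC (F V : factors) : cross_constr F V = cross_constr V F.
Proof. by apply: eq_bigr => c _; rewrite symcrossC. Qed.

Lemma cost_linear (F U V : factors) (h : R) :
  \sum_c mxdot (val (C c)) (val (symcross (F c) (fadd h U V c))) =
  h * (\sum_c mxdot (val (C c)) (val (symcross (F c) (U c)))) +
  \sum_c mxdot (val (C c)) (val (symcross (F c) (V c))).
Proof.
rewrite mulr_sumr -big_split; apply: eq_bigr => c _.
by rewrite /fadd symcross_linear symvalD (symvalZ h) mxdotDr mxdotZr.
Qed.

Lemma d2PhiC (F U V : factors) : d2Phi F U V = d2Phi F V U.
Proof.
rewrite /d2Phi (cross_constrC U V) (mxdotC (cross_constr F U)); congr (_ - _ + _).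
by apply: eq_bigr => c _; rewrite symcrossC.
Qed.

Lemma d2Phi_linear (F W U V : factors) (h : R) :
  d2Phi F W (fadd h U V) = h * d2Phi F W U + d2Phi F W V.
Proof.
rewrite /d2Phi cost_linear !cross_constr_linear.
move: (cross_constr F W) (cross_constr F U) (cross_constr F V) (multiplier F)
  (cross_constr W U) (cross_constr W V) => u v w z s t.
by rewrite !mxdotDr !mxdotZr; ring.
Qed.

Lemma dPhi_expand (F U V : factors) :
  exists u v, forall h, dPhi (fadd h U F) V =
    dPhi F V + (h * d2Phi F U V + (h ^+ 2 * u + (h ^+ 3 * v + h ^+ 4 * 0))).
Proof.
exists (rho * (mxdot (cross_constr F U) (cross_constr V U) +
    mxdot (gram_constr U) (cross_constr V F))),
  (rho * mxdot (gram_constr U) (cross_constr V U)) => h.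
rewrite /dPhi /d2Phi /multiplier constr_expand.
have -> : \sum_c mxdot (val (C c)) (val (symcross (fadd h U F c) (V c))) =
   h * (\sum_c mxdot (val (C c)) (val (symcross (U c) (V c)))) +
   \sum_c mxdot (val (C c)) (val (symcross (F c) (V c))).
  transitivity (\sum_c mxdot (val (C c)) (val (symcross (V c) (fadd h U F c)))).
    by apply: eq_bigr => c _; rewrite symcrossC.
  rewrite cost_linear; congr (_ * _ + _); apply: eq_bigr => c _; by rewrite symcrossC.
rewrite (cross_constrC _ V) cross_constr_linear (cross_constrC U V) (cross_constrC F V).
move: (constr A b F) (cross_constr V U) (cross_constr V F) (gram_constr U) => u v w z.
move: (cross_constr F U) => t.
rewrite !scalerDr !mxdotDl !mxdotNl !mxdotDl !mxdotDr !mxdotZl !mxdotZr.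
by ring.
Qed.
End Derivatives.

(** * Gradient and curvature in terms of the slack matrices *)

Lemma row_form_expand (R : realType) (N : nat) (f : 'rV[R]_N -> R) (v : 'rV[R]_N) :
  (forall h u w, f (h *: u + w) = h * f u + f w) ->
  f v = \sum_j v 0 j * f (delta_mx 0 j).
Proof.
move=> fl; have f0 : f 0 = 0.
  have := fl 0 0 0; rewrite scale0r add0r mul0r add0r => h.
  by have := fl 1 0 0; rewrite scale1r addr0 mul1r => /eqP;
    rewrite -subr_eq subrr eq_sym => /eqP.
rewrite [in LHS](row_sum_delta v).
elim/big_rec2 : _ => [//|j a w _ IH].
by rewrite fl IH.
Qed.

Lemma mxdot_delta (R : realType) (N : nat) (v : 'rV[R]_N) (i : 'I_N) :
  mxdot v (delta_mx 0 i) = v 0 i.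
Proof.
rewrite /mxdot big_ord1 (bigD1 i) //= mxE !eqxx mulr1 big1 ?addr0 // => j ji.
by rewrite mxE (negbTE ji) andbF mulr0.
Qed.

Lemma mxdot_vec_mx (R : realType) (p r : nat) (u w : 'rV[R]_(p * r)) :
  mxdot (vec_mx u) (vec_mx w) = mxdot u w.
Proof.
rewrite [RHS]/mxdot big_ord1 /mxdot pair_big /=.
rewrite [RHS](reindex (uncurry (@mxvec_index p r))) /=; last first.
  exact: curry_mxvec_bij.
by apply: eq_bigr => -[i j] _ /=; rewrite !mxE.
Qed.

Lemma mxdot_unflatten (R : realType) (q : nat) (n k : 'I_q -> nat)
    (x z : 'rV[R]_(\sum_c n c * k c)) :
  \sum_c mxdot (unflatten_factors x c) (unflatten_factors z c) = mxdot x z.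
Proof.
have rowdot N (u w : 'rV[R]_N) : mxdot u w = (u *m w^T) 0 0.
  by rewrite /mxdot big_ord1 mxE; apply: eq_bigr => j _; rewrite mxE.
rewrite [RHS]rowdot -{2}(submxrowK x) -{2}(submxrowK z) tr_mxrow mul_mxrow_mxcol summxE.
by apply: eq_bigr => c _; rewrite mxdot_vec_mx rowdot.
Qed.

Lemma unflatten_linear (R : realType) (q : nat) (n k : 'I_q -> nat) (h : R)
    (x z : 'rV[R]_(\sum_c n c * k c)) :
  unflatten_factors (h *: x + z) =
  fadd h (unflatten_factors x) (unflatten_factors z) :> factors R n k.
Proof.
apply: functional_extensionality_dep => c; rewrite /fadd /unflatten_factors.
by apply/matrixP => i j; rewrite !mxE.
Qed.

Lemma unflattenK (R : realType) (q : nat) (n k : 'I_q -> nat) (F : factors R n k) :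
  unflatten_factors (flatten_factors F) = F.
Proof. by apply: functional_extensionality_dep => c; exact: flatten_factorsK. Qed.

Section Stationarity.
Variables (R : realType) (q m : nat) (n k : 'I_q -> nat).
Variables (A : forall c, 'Hom(symmx R (n c), 'cV[R]_m)) (b : 'cV[R]_m).
Variables (C : forall c, symmx R (n c)) (rho : R) (y : 'cV[R]_m).
Local Notation factors := (factors R n k).
Local Notation f := (fun x => Phi A b C rho y (unflatten_factors x : factors)).
Local Notation dPhi := (dPhi A b C rho y).
Local Notation d2Phi := (d2Phi A b C rho y).
Local Notation multiplier := (multiplier A b rho y).

Lemma partial_Phi i x :
  partial f i x = dPhi (unflatten_factors x) (unflatten_factors (delta_mx 0 i)).
Proof.
have [u [v [w E]]] := Phi_expand A b C rho y (unflatten_factors x)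
  (unflatten_factors (delta_mx 0 i) : factors).
apply: (derive_polynomial (a := u) (b := v) (c := w)) => h.
by rewrite unflatten_linear E.
Qed.

Lemma hessian_Phi i j x :
  hessian f x i j = d2Phi (unflatten_factors x) (unflatten_factors (delta_mx 0 i))
    (unflatten_factors (delta_mx 0 j)).
Proof.
rewrite mxE /partial.
have -> : (fun x0 => 'D_(delta_mx 0 j) f x0) =
    fun x0 => dPhi (unflatten_factors x0) (unflatten_factors (delta_mx 0 j)).
  by apply/funext => z; rewrite -partial_Phi.
have [u [v E]] := dPhi_expand A b C rho y (unflatten_factors x)
  (unflatten_factors (delta_mx 0 i)) (unflatten_factors (delta_mx 0 j) : factors).
apply: (derive_polynomial (a := u) (b := v) (c := 0)) => h.
by rewrite unflatten_linear E.
Qed.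

Lemma hess_form (F V : factors) :
  mxdot (flatten_factors V *m hess_Phi A b C rho y F) (flatten_factors V) =
  d2Phi F V V.
Proof.
set v := flatten_factors V; set H := hess_Phi _ _ _ _ _ _.
have HE i j : H i j = d2Phi F (unflatten_factors (delta_mx 0 i))
    (unflatten_factors (delta_mx 0 j)).
  by rewrite /H /hess_Phi hessian_Phi unflattenK.
rewrite -[in RHS](unflattenK V) -/v.
rewrite (row_form_expand (f := fun z => d2Phi F (unflatten_factors v) (unflatten_factors z)));
  last by move=> h u w; rewrite unflatten_linear d2Phi_linear.
rewrite /mxdot big_ord1; apply: eq_bigr => j _; rewrite mulrC; congr (_ * _).
rewrite d2PhiC (row_form_expand (f := fun z => d2Phi F (unflatten_factors (delta_mx 0 j))
  (unflatten_factors z)));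
  last by move=> h u w; rewrite unflatten_linear d2Phi_linear.
by rewrite mxE; apply: eq_bigr => i _; rewrite HE d2PhiC.
Qed.

Lemma hess_sym (F : factors) :
  (hess_Phi A b C rho y F)^T = hess_Phi A b C rho y F.
Proof. by apply/matrixP => i j; rewrite mxE /hess_Phi !hessian_Phi d2PhiC. Qed.

Lemma slack_sym c l : (slack (A c) (C c) l)^T = slack (A c) (C c) l.
Proof.
by rewrite linearB /= (symvP _ (subvsP (C c))) (symvP _ (subvsP (adjmap (A c) l))).
Qed.

(** Adjointness turns costs and multiplier into the slack matrices. *)
Lemma lagrangian_cross (F U V : factors) :
  \sum_c mxdot (val (C c)) (val (symcross (U c) (V c)))
  - mxdot (multiplier F) (cross_constr A U V) =
  \sum_c 2 * mxdot (slack (A c) (C c) (multiplier F) *m U c) (V c).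
Proof.
have -> : mxdot (multiplier F) (cross_constr A U V) =
    \sum_c mxdot (multiplier F) (A c (symcross (U c) (V c))).
  by rewrite /cross_constr linear_sum.
rewrite -sumrB; apply: eq_bigr => c _.
rewrite adjmapP -mxdotNl -mxdotDl -/(slack (A c) (C c) (multiplier F)).
set S := slack _ _ _.
rewrite symcrossE mxdotDr mulr2n mulrDl mul1r; congr (_ + _).
  by rewrite -mxdot_tr slack_sym trmx_mul trmxK [RHS]mxdot_mulr.
by rewrite [RHS]mxdot_mulr.
Qed.

Lemma dPhiE (F V : factors) :
  dPhi F V = \sum_c mxdot (2 *: (slack (A c) (C c) (multiplier F) *m F c)) (V c).
Proof.
rewrite /dPhi lagrangian_cross.
by apply: eq_bigr => c _; rewrite mxdotZl.
Qed.

Lemma grad_PhiE (F : factors) c :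
  grad_Phi A b C rho y F c = 2 *: (slack (A c) (C c) (multiplier F) *m F c).
Proof.
pose G : factors := fun c => 2 *: (slack (A c) (C c) (multiplier F) *m F c).
rewrite -[RHS]/(G c) -(unflattenK G) /grad_Phi; congr (unflatten_factors _ c).
apply/rowP => i; rewrite mxE partial_Phi unflattenK dPhiE.
transitivity (\sum_c mxdot (unflatten_factors (flatten_factors G) c)
   (unflatten_factors (delta_mx 0 i) c)); first by rewrite unflattenK.
by rewrite mxdot_unflatten mxdot_delta.
Qed.

Lemma oplus_norm_grad (F : factors) :
  oplus_norm (grad_Phi A b C rho y F) =
  2 * Num.sqrt (\sum_c mxnorm2 (slack (A c) (C c) (multiplier F) *m F c) ^+ 2).
Proof.
rewrite /oplus_norm -[2 in RHS]ger0_norm // -sqrtr_sqr -sqrtrM ?sqr_ge0 // mulr_sumr.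
congr Num.sqrt; apply: eq_bigr => c _.
by rewrite grad_PhiE mxnorm2Z exprMn ger0_norm.
Qed.

(** Test the Hessian on the direction [u *m v^T] in block [c]. The penalty term is
small when [F c *m v] is; what remains is the quadratic form of the slack at [u]. *)
Lemma block_curvature (F : factors) c (u : 'cV[R]_(n c)) (v : 'cV[R]_(k c)) :
  0 <= rho -> mxnorm2 v = 1 ->
  lambda_min (hess_Phi A b C rho y F) * mxnorm2 u ^+ 2 <=
  2 * (u^T *m slack (A c) (C c) (multiplier F) *m u) 0 0 +
  4 * rho * (opnormF2 (A c) * mxnorm2 (F c *m v)) ^+ 2 * mxnorm2 u ^+ 2.
Proof.
move=> rho0 v1; pose M := u *m v^T.
pose V : factors := eqtype.dfwith (fun c' => 0 : 'M[R]_(n c', k c')) M.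
have Vc : V c = M by rewrite /V eqtype.dfwith_in.
have Vo c' : c' != c -> V c' = 0 by move=> cc'; rewrite /V eqtype.dfwith_out // eq_sym.
have MM (P Q : 'M[R]_(n c)) : mxdot (P *m M) (Q *m M) = mxdot (P *m u) (Q *m u).
  rewrite /M !mulmxA mxdot_mulr trmxK -mulmxA.
  have -> : v^T *m v = 1%:M.
    apply/matrixP => i j; rewrite !ord1 [RHS]mxE eqxx -(expr1n R 2) -v1 sqr_mxnorm2 mxE.
    by rewrite /mxdot; apply: eq_bigr => l _; rewrite big_ord1 mxE.
  by rewrite mulmx1.
have normV : mxdot (flatten_factors V) (flatten_factors V) = mxnorm2 u ^+ 2.
  rewrite -mxdot_unflatten unflattenK (bigD1 c) //= Vc [X in _ + X]big1 ?addr0.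
    by have := MM 1%:M 1%:M; rewrite !mul1mx sqr_mxnorm2.
  by move=> c' cc'; rewrite Vo // linear0.
have crossV : cross_constr A F V = A c (symcross (F c) M).
  rewrite /cross_constr (bigD1 c) //= Vc [X in _ + X]big1 ?addr0 // => c' cc'.
  have -> : symcross (F c') (V c') = 0.
    by apply: val_inj; rewrite symcrossE Vo // trmx0 mulmx0 mul0mx addr0.
  by rewrite linear0.
have crossn : mxnorm2 (A c (symcross (F c) M)) <=
    2 * (opnormF2 (A c) * mxnorm2 (F c *m v)) * mxnorm2 u.
  apply: le_trans (mxnorm2_opnormF2 _ _) _.
  have -> : 2 * (opnormF2 (A c) * mxnorm2 (F c *m v)) * mxnorm2 u =
     opnormF2 (A c) * (2 * (mxnorm2 (F c *m v) * mxnorm2 u)) by ring.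
  rewrite ler_wpM2l ?opnormF2_ge0 // symcrossE.
  apply: le_trans (mxnorm2D _ _) _.
  have h1 : mxnorm2 (F c *m M^T) <= mxnorm2 (F c *m v) * mxnorm2 u.
    rewrite /M trmx_mul trmxK mulmxA; apply: le_trans (mxnorm2_mul _ _) _.
    by rewrite mxnorm2_tr.
  have h2 : mxnorm2 (M *m (F c)^T) = mxnorm2 (F c *m M^T).
    by rewrite -mxnorm2_tr trmx_mul trmxK.
  by rewrite h2; lra.
have := lambda_min_rayleigh (flatten_factors V) (hess_sym F).
rewrite hess_form normV => h; apply: le_trans h _.
rewrite /d2Phi lagrangian_cross; apply: lerD.
  rewrite (bigD1 c) //= Vc [X in _ + X]big1 ?addr0; last first.
    by move=> c' cc'; rewrite Vo // linear0 mulr0.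
  have := MM (slack (A c) (C c) (multiplier F)) 1%:M; rewrite !mul1mx => ->.
  by rewrite quad_mxdot mxdotC.
rewrite crossV -sqr_mxnorm2.
rewrite [leRHS](_ : _ = rho *
   (2 * (opnormF2 (A c) * mxnorm2 (F c *m v)) * mxnorm2 u) ^+ 2); last by ring.
rewrite ler_wpM2l // ler_sqr ?nnegrE ?mxnorm2_ge0 //.
by rewrite !mulr_ge0 ?opnormF2_ge0 ?mxnorm2_ge0.
Qed.
End Stationarity.

(** * Approximate optimality of a stationary output *)

Lemma psd_gram (R : realType) (n k : nat) (F : 'M[R]_(n, k)) : psd (val (gram F)).
Proof.
split; first exact: symvP (subvsP (gram F)).
move=> v; rewrite quad_mxdot [val (gram F)]/(F *m F^T) -mulmxA mxdotC mxdot_mull.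
exact: mxdot_ge0.
Qed.

Lemma loewner_geN (R : realType) (n : nat) (S : 'M[R]_n) (e : R) :
  S^T = S ->
  (forall v : 'cV[R]_n, - e * mxnorm2 v ^+ 2 <= (v^T *m S *m v) 0 0) <->
  loewner_ge S (- e)%:M.
Proof.
move=> ST; have E (v : 'cV[R]_n) : (v^T *m (S - (- e)%:M) *m v) 0 0 =
    (v^T *m S *m v) 0 0 - (- e * mxnorm2 v ^+ 2).
  by rewrite !quad_mxdot mulmxBl mul_scalar_mx mxdotDr mxdotNr mxdotZr sqr_mxnorm2.
split=> [h|[_ h] v]; last by have := h v; rewrite E subr_ge0.
split; first by rewrite linearB /= ST tr_scalar_mx.
by move=> v; rewrite E subr_ge0.
Qed.

Lemma block_le_oplus (R : realType) (q : nat) (a : 'I_q -> R) (s : R) c :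
  (forall c, 0 <= a c) -> Num.sqrt (\sum_c a c ^+ 2) <= s -> a c <= s.
Proof.
move=> a0; apply: le_trans; rewrite -[a c]ger0_norm // -sqrtr_sqr ler_wsqrtr //.
by rewrite (bigD1 c) //= lerDl; apply: sumr_ge0 => c' _; exact: sqr_ge0.
Qed.

Lemma l2_triangle (R : realType) (q : nat) (z a b : 'I_q -> R) :
  (forall c, 0 <= z c <= a c + b c) ->
  Num.sqrt (\sum_c z c ^+ 2) <=
  Num.sqrt (\sum_c a c ^+ 2) + Num.sqrt (\sum_c b c ^+ 2).
Proof.
move=> zab.
have normE (f : 'I_q -> R) : Num.sqrt (\sum_c f c ^+ 2) = mxnorm2 (\row_c f c).
  by rewrite /mxnorm2 /mxdot big_ord1; congr Num.sqrt; apply: eq_bigr => c _; rewrite mxE expr2.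
apply: (@le_trans _ _ (Num.sqrt (\sum_c (a c + b c) ^+ 2))).
  rewrite ler_wsqrtr //; apply: ler_sum => c _; have /andP[z0 h] := zab c.
  by rewrite ler_sqr // nnegrE // (le_trans z0).
rewrite !normE; apply: le_trans (mxnorm2D _ _).
rewrite le_eqVlt; apply/orP; left; apply/eqP; congr mxnorm2.
by apply/rowP => c; rewrite !mxE.
Qed.

Section Certificates.
Variables (R : realType) (q m : nat) (n k : 'I_q -> nat).
Variables (A : forall c, 'Hom(symmx R (n c), 'cV[R]_m)) (b : 'cV[R]_m).

(** The gradient at [F] is twice the slack times [F], which bounds the slack times
[F F^T]; the curvature along the degenerate directions bounds the slack below. *)
Lemma sampled_certificate (C : forall c, symmx R (n c)) (F : factors R n k)
    (y : 'cV[R]_m) (rho dbar wbar zbar rhobar gam RF : R) :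
  let yhat := y - rho *: constr A b F in
  0 < gam -> 0 < RF ->
  0 < rho <= rhobar -> mxnorm2 (constr A b F) <= dbar ->
  oplus_norm (grad_Phi A b C rho y F) <= wbar ->
  - zbar <= lambda_min (hess_Phi A b C rho y F) ->
  oplus_norm F <= RF ->
  (forall c, exists2 v : 'cV[R]_(k c), mxnorm2 v = 1 &
     opnormF2 (A c) * mxnorm2 (F c *m v) <= gam) ->
  approx_optimal A b C dbar (RF * (wbar / 2)) (zbar / 2 + 2 * rhobar * gam ^+ 2)
    (fun c => gram (F c)) yhat.
Proof.
move=> yhat g0 RF0 /andP[rho0 rhob] cb gradb hessb FRF deg.
have SE c : (slack (A c) (C c) yhat)^T = slack (A c) (C c) yhat by exact: slack_sym.
split => //; first by move=> c; exact: psd_gram.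
- have FcRF c : mxnorm2 (F c) <= RF.
    by apply: (block_le_oplus (a := fun c => mxnorm2 (F c))) => // c'; exact: mxnorm2_ge0.
  rewrite oplus_norm_grad -/yhat in gradb.
  apply: (@le_trans _ _ (RF * Num.sqrt (\sum_c mxnorm2 (slack (A c) (C c) yhat *m F c) ^+ 2))).
    rewrite -[X in _ <= X * _]ger0_norm ?(ltW RF0) // -sqrtr_sqr -sqrtrM ?sqr_ge0 //.
    rewrite ler_wsqrtr // mulr_sumr; apply: ler_sum => c _.
    rewrite -exprMn ler_sqr ?nnegrE ?mulr_ge0 ?mxnorm2_ge0 ?(ltW RF0) //.
    rewrite [val (gram (F c))]/(F c *m (F c)^T) mulmxA mulrC.
    apply: le_trans (mxnorm2_mul _ _) _; rewrite mxnorm2_tr.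
    by rewrite ler_wpM2l ?mxnorm2_ge0.
  rewrite ler_pM2l // ler_pdivlMr // mulrC //.
move=> c; apply/loewner_geN => // u.
have [v v1 av] := deg c.
have := block_curvature A b C y F u (ltW rho0) v1; rewrite -/yhat => h.
set S := (u^T *m _ *m u) 0 0; set N := mxnorm2 u ^+ 2.
have N0 : 0 <= N by exact: sqr_ge0.
have h1 : - zbar * N <= lambda_min (hess_Phi A b C rho y F) * N by rewrite ler_wpM2r.
have a0 : 0 <= opnormF2 (A c) * mxnorm2 (F c *m v).
  by rewrite mulr_ge0 ?opnormF2_ge0 ?mxnorm2_ge0.
have h2 : (opnormF2 (A c) * mxnorm2 (F c *m v)) ^+ 2 <= gam ^+ 2.
  by rewrite ler_sqr ?nnegrE // ltW.
have h3 : 4 * rho * (opnormF2 (A c) * mxnorm2 (F c *m v)) ^+ 2 * N <=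
    4 * rhobar * gam ^+ 2 * N.
  have hr : 4 * rho <= 4 * rhobar by rewrite ler_pM2l.
  have r4 : 0 <= 4 * rho by rewrite mulr_ge0 // ltW.
  by rewrite ler_wpM2r // (ler_pM r4 (sqr_ge0 _) hr h2).
have {}h := le_trans h1 (le_trans h (lerD (lexx _) h3)).
rewrite -/S in h; move: h; set G := gam ^+ 2; lra.
Qed.

(** Exchanging the costs moves each slack matrix by at most [s] in Frobenius norm,
hence in operator norm, and the norms of the [X c] add up to at most [RF ^ 2]. *)
Lemma nominal_certificate (C Cbar : forall c, symmx R (n c)) (F : factors R n k)
    (l : 'cV[R]_m) (e0 e1 e2 s RF : R) :
  0 <= s -> 0 < RF -> oplus_norm F <= RF ->
  (forall c, mxnorm2 (val (C c) - val (Cbar c)) <= s) ->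
  approx_optimal A b C e0 e1 e2 (fun c => gram (F c)) l ->
  approx_optimal A b Cbar e0 (e1 + s * RF ^+ 2) (e2 + s) (fun c => gram (F c)) l.
Proof.
move=> s0 RF0 FRF Cs [h0 h1 h2 h3].
have SE c : slack (A c) (Cbar c) l =
    slack (A c) (C c) l - (val (C c) - val (Cbar c)).
  by rewrite /slack opprB [RHS]addrC addrA subrK.
split => //.
  apply: le_trans (l2_triangle (a := fun c => mxnorm2 (slack (A c) (C c) l *m val (gram (F c))))
    (b := fun c => s * mxnorm2 (F c) ^+ 2) _) _.
    move=> c; rewrite mxnorm2_ge0 SE mulmxBl /=.
    apply: le_trans (mxnorm2D _ _) _; rewrite lerD2l mxnorm2N.
    apply: le_trans (mxnorm2_mul _ _) _.
    apply: ler_pM; rewrite ?mxnorm2_ge0 //.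
    by apply: le_trans (mxnorm2_mul _ _) _; rewrite mxnorm2_tr expr2.
  apply: lerD => //.
  have FRF2 : \sum_c mxnorm2 (F c) ^+ 2 <= RF ^+ 2.
    rewrite -[leLHS]sqr_sqrtr ?sumr_ge0 // => [|c _]; last exact: sqr_ge0.
    by rewrite ler_sqr ?nnegrE ?sqrtr_ge0 ?(ltW RF0).
  have S0 : 0 <= \sum_c mxnorm2 (F c) ^+ 2 by apply: sumr_ge0 => c _; exact: sqr_ge0.
  apply: (@le_trans _ _ (s * \sum_c mxnorm2 (F c) ^+ 2)); last by rewrite ler_wpM2l.
  rewrite -[leRHS]ger0_norm ?mulr_ge0 // -sqrtr_sqr ler_wsqrtr // exprMn.
  under eq_bigr do rewrite exprMn.
  rewrite -mulr_sumr ler_wpM2l ?sqr_ge0 // [leRHS]expr2 mulr_suml.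
  apply: ler_sum => c _; rewrite expr2 ler_wpM2l ?sqr_ge0 //.
  by rewrite (bigD1 c) //= lerDl; apply: sumr_ge0 => c' _; exact: sqr_ge0.
move=> c; apply/loewner_geN; first exact: slack_sym.
have /loewner_geN h := h3 c; move=> v.
have {}h := h (slack_sym A C c l) v.
rewrite quad_mxdot in h; rewrite SE quad_mxdot mulmxBl mxdotDr mxdotNr.
have : mxdot v ((val (C c) - val (Cbar c)) *m v) <= s * mxnorm2 v ^+ 2.
  apply: le_trans (mxdot_cauchy _ _) _; rewrite expr2 mulrCA.
  rewrite ler_wpM2l ?mxnorm2_ge0 //; apply: le_trans (mxnorm2_mulv _ _) _.
  by rewrite ler_wpM2r ?mxnorm2_ge0.
lra.
Qed.
End Certificates.

(** * Blocks with a degenerate direction, and the union bound *)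

Lemma scaled_lower_bound (R : realType) (n k : nat) (F : 'M[R]_(n, k)) (g : R) :
  (forall v : 'cV[R]_k, mxnorm2 v = 1 -> g <= mxnorm2 (F *m v)) ->
  forall v : 'cV[R]_k, g * mxnorm2 v <= mxnorm2 (F *m v).
Proof.
move=> h v; have [->|v0] := eqVneq v 0; first by rewrite mulmx0 !mxnorm20 mulr0.
have nv := mxnorm2_gt0 v0.
have := h ((mxnorm2 v)^-1 *: v).
rewrite -scalemxAr !mxnorm2Z ger0_norm ?invr_ge0 ?mxnorm2_ge0 // mulVf ?lt0r_neq0 //.
by move=> /(_ erefl); rewrite mulrC ler_pdivlMr.
Qed.

Lemma unit_vector (R : realType) (k : nat) (v : 'cV[R]_k) : v != 0 ->
  mxnorm2 ((mxnorm2 v)^-1 *: v) = 1.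
Proof.
move=> v0; have nv := mxnorm2_gt0 v0.
by rewrite mxnorm2Z ger0_norm ?invr_ge0 ?mxnorm2_ge0 // mulVf ?lt0r_neq0.
Qed.

Lemma exists_unit_vector (R : realType) (k : nat) : (0 < k)%N ->
  exists v : 'cV[R]_k, mxnorm2 v = 1.
Proof.
move=> k0; exists ((mxnorm2 (const_mx 1 : 'cV[R]_k))^-1 *: const_mx 1).
apply: unit_vector; apply/eqP => /matrixP/(_ (Ordinal k0) 0)/eqP.
by rewrite !mxE oner_eq0.
Qed.

Lemma wide_degenerate (R : realType) (n k : nat) (F : 'M[R]_(n, k)) : (n < k)%N ->
  exists2 v : 'cV[R]_k, mxnorm2 v = 1 & F *m v = 0.
Proof.
move=> nk; have [|v v0 Fv] := @kernel_vector _ n k F.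
  by rewrite /row_full neq_ltn (leq_ltn_trans (rank_leq_row F) nk).
exists ((mxnorm2 v)^-1 *: v); first exact: unit_vector.
by rewrite -scalemxAr Fv scaler0.
Qed.

Theorem corollary2 (R : realType)
  (q m : nat) (n : 'I_q -> nat)
  (q_gt0 : (0 < q)%N) (m_gt0 : (0 < m)%N) (n_gt0 : forall c, (0 < n c)%N)
  (b : 'cV[R]_m) (A : forall c, 'Hom(symmx R (n c), 'cV[R]_m))
  (A_rank : \dim (total_range A) = m)
  (dbar wbar zbar rhobar gam RF Ry : R)
  (dbar_gt0 : 0 < dbar) (wbar_gt0 : 0 < wbar) (zbar_gt0 : 0 < zbar)
  (rhobar_gt0 : 0 < rhobar) (gam_gt0 : 0 < gam)
  (RF_gt0 : 0 < RF) (Ry_gt0 : 0 < Ry)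
  (k : 'I_q -> nat) (k_gt0 : forall c, (0 < k c)%N)
  (Cbar : forall c, symmx R (n c))
  (sigma : 'I_q -> R) (sigma_gt0 : forall c, 0 < sigma c)
  (d : measure_display) (Omega : measurableType d) (P : probability Omega R)
  (C : forall c, Omega -> symmx R (n c))
  (C_uniform : forall c, uniform_frob_ball P (C c) (Cbar c) (sigma c))
  (C_indep : mutually_independent P C)
  (F : Omega -> factors R n k) (y : Omega -> 'cV[R]_m) (rho : Omega -> R) :
  let eps0 := dbar in
  let eps1 := wbar / 2 in
  let eps2 := zbar / 2 + 2 * rhobar * gam ^+ 2 in
  let a c := opnormF2 (A c) in
  let J : {set 'I_q} := [set c | (k c <= n c)%N && (0 < a c)]%SET in
  let delta c := eps1 * a c / gam in
  let kappa c := Ry * a c in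
  let p c := 4 * expR 1 * (3 * kappa c / delta c) ^+ maprank (A c)
             * (4 * (n c)%:R ^+ 3 * delta c / sigma c) ^+ tau (k c) in
  let yhat w := y w - rho w *: constr A b (F w) in
  let X w c := gram (F w c) in
  let Cw w c := C c w in
  let sigma_max := \big[Num.max/0]_c sigma c in
  (forall c, c \in J ->
    [/\ (maprank (A c) < tau (k c))%N,
        0 < delta c <= kappa c &
        delta c < sigma c / (4 * (n c)%:R ^+ 3)]) ->
  {ae P, forall w,
    [/\ 0 < rho w <= rhobar,
        mxnorm2 (constr A b (F w)) <= dbar,
        oplus_norm (grad_Phi A b (Cw w) (rho w) (y w) (F w)) <= wbar,
        - zbar <= lambda_min (hess_Phi A b (Cw w) (rho w) (y w) (F w)) &
        oplus_norm (F w) <= RF /\ mxnorm2 (yhat w) <= Ry]} ->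
  exists E : set Omega,
    [/\ measurable E,
        ((1 - \sum_(c in J) p c)%:E <= P E)%E &
        forall w, E w ->
        [/\ approx_optimal A b (Cw w) eps0 (RF * eps1) eps2 (X w) (yhat w),
            approx_optimal A b Cbar
              eps0 (RF * eps1 + sigma_max * RF ^+ 2) (eps2 + sigma_max)
              (X w) (yhat w) &
            forall tau_dual : R, eps2 <= tau_dual ->
              ~ exists (c : 'I_q) (v : 'cV[R]_(n c)), mxnorm2 v = 1 /\
                  (v^T *m slack (A c) (Cw w c) (yhat w) *m v) 0 0 < - tau_dual]].
Proof.
move=> eps0 eps1 eps2 a J delta kappa p yhat X Cw sigma_max hJ hrun.
have eps1_gt0 : 0 < eps1 by rewrite divr_gt0.
(* [N] is the null set of runs that violate the terminal conditions. *)
have [N [mN N0 hN]] := hrun.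
have hB c : exists B : set Omega, [/\ measurable B,
    (P B <= (if c \in J then p c else 0)%:E)%E &
    c \in J -> forall w l (G : 'M[R]_(n c, k c)) (g : R), 0 < g ->
      mxnorm2 (val (adjmap (A c) l)) <= kappa c ->
      (forall v : 'cV[R]_(k c), g * mxnorm2 v <= mxnorm2 (G *m v)) ->
      mxnorm2 (slack (A c) (C c w) l *m G) <= delta c * g -> B w].
  have [cJ|cJ] := boolP (c \in J); last by exists set0; rewrite measure0; split.
  have [_ dk _] := hJ c cJ.
  have [B [mB PB hB]] := bad_block (n_gt0 c) (sigma_gt0 c) (C_uniform c) (A c) (k_gt0 c) dk.
  exists B; split => //.
  have T0 := le_trans (measure_ge0 P B) PB; rewrite lee_fin in T0.
  apply: le_trans PB _; rewrite lee_fin [leRHS](_ : _ = 4 * (expR 1 *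
    (3 * kappa c / delta c) ^+ maprank (A c) *
    (4 * (n c)%:R ^+ 3 * delta c / sigma c) ^+ tau (k c))); last by rewrite /p !mulrA.
  by rewrite ler_peMl // ler1n.
pose B c := sval (cid (hB c)).
have BP c := svalP (cid (hB c)).
pose O c := [set w | ~ (mxnorm2 (val (C c w) - val (Cbar c)) <= sigma c)].
have mO c : measurable (O c).
  have := measurable_event (C_uniform c)
    (measurableC (measurable_tball (fun t => tnth (svec (Cbar c)) t) (sigma c))).
  congr measurable; apply/seteqP.
  by split => w /=; rewrite /tball /O /= svec_isometry ler_sqr ?nnegrE
    ?mxnorm2_ge0 ?(ltW (sigma_gt0 c)).
have mB c : measurable (B c) by have [] := BP c.
pose BU := \big[setU/set0]_c B c; pose OU := \big[setU/set0]_c O c.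
have mBU : measurable BU by apply: bigsetU_measurable.
have mOU : measurable OU by apply: bigsetU_measurable.
have PBU : (P BU <= (\sum_(c in J) p c)%:E)%E.
  rewrite [in leRHS]big_mkcond; apply: measure_bigsetU_le => // c.
  by have [] := BP c.
have POU : (P OU <= 0)%E.
  have -> : (0 = (\sum_(c < q) (0 : R))%:E)%E by rewrite big1.
  apply: measure_bigsetU_le => // c.
  have PO : P (O c) = 0%E := outside_ball_null (sigma_gt0 c) (C_uniform c).
  have {}PO : (P (O c) <= 0)%E by rewrite PO.
  exact: PO.
have mU : measurable (N `|` OU `|` BU) by do 2 (apply: measurableU => //).
exists (~` (N `|` OU `|` BU)); split; first exact: measurableC.
  rewrite probability_setC // EFinB leeB //.
  apply: le_trans (measureU2 _ _ _) _ => //; first exact: measurableU.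
  rewrite -[leRHS]add0e; apply: leeD => //.
  apply: le_trans (measureU2 _ _ _) _ => //.
  have N0' : (P N <= 0)%E by rewrite N0.
  by rewrite -[leRHS]add0e; apply: leeD.
move=> w /not_orP[/not_orP[Nw OUw] BUw].
have notB c : ~ B c w.
  by move=> Bw; apply: BUw; rewrite /BU -bigcup_seq; exists c; rewrite //= mem_index_enum.
have inball c : mxnorm2 (val (C c w) - val (Cbar c)) <= sigma c.
  apply: contrapT => Ow; apply: OUw; rewrite /OU -bigcup_seq.
  by exists c; rewrite //= mem_index_enum.
have [/andP[rho0 rhob] cb gradb hessb [FRF yRy]] :
    [/\ 0 < rho w <= rhobar,
        mxnorm2 (constr A b (F w)) <= dbar,
        oplus_norm (grad_Phi A b (Cw w) (rho w) (y w) (F w)) <= wbar,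
        - zbar <= lambda_min (hess_Phi A b (Cw w) (rho w) (y w) (F w)) &
        oplus_norm (F w) <= RF /\ mxnorm2 (yhat w) <= Ry].
  by apply: contrapT => h; apply: Nw; apply: hN.
(* Wide blocks have a kernel, and blocks on which the constraint map vanishes satisfy
   the bound for every [v]; the others belong to [J], where the event excludes that
   [F w c] is bounded below. *)
have deg c : exists2 v : 'cV[R]_(k c), mxnorm2 v = 1 & a c * mxnorm2 (F w c *m v) <= gam.
  have [kn|nk] := leqP (k c) (n c); last first.
    have [v v1 Fv] := wide_degenerate (F w c) nk.
    by exists v; rewrite // Fv mxnorm20 mulr0 ltW.
  have [a0|a0] := ltP 0 (a c); last first.
    have [v v1] := exists_unit_vector R (k_gt0 c); exists v => //.
    by apply: le_trans (ltW gam_gt0); rewrite mulr_le0_ge0 ?mxnorm2_ge0.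
  have cJ : c \in J by rewrite inE kn a0.
  apply: contrapT => nv.
  have [_ _ /(_ cJ) hBad] := BP c.
  apply: (notB c); apply: (hBad w (yhat w) (F w c) (gam / a c)).
  - by rewrite divr_gt0.
  - apply: le_trans (mxnorm2_adjmap _ _) _.
    by rewrite /kappa mulrC ler_wpM2r ?(ltW a0).
  - apply: scaled_lower_bound => v v1; rewrite leNgt; apply/negP => hv.
    by apply: nv; exists v => //; rewrite mulrC -ler_pdivlMr // ltW.
  rewrite (_ : delta c * (gam / a c) = eps1); last first.
    by rewrite /delta; field; rewrite !lt0r_neq0.
  rewrite oplus_norm_grad -ler_pdivlMl // mulrC in gradb.
  exact: (@block_le_oplus R q (fun c => mxnorm2 (slack (A c) (C c w) (yhat w) *m F w c))
    _ c (fun c' => mxnorm2_ge0 _) gradb).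
have cert : approx_optimal A b (Cw w) eps0 (RF * eps1) eps2 (X w) (yhat w).
  apply: (@sampled_certificate R q m n k A b (Cw w) (F w) (y w) (rho w)) => //.
  by rewrite rho0 rhob.
split => //.
  apply: nominal_certificate cert => //.
    by rewrite /sigma_max; elim/big_ind : _ => [//|u v u0 v0|c _];
      [rewrite le_max u0|exact: ltW].
  by move=> c; apply: le_trans (inball c) _; apply: le_bigmax.
move=> td tde [c [v [v1 hv]]].
have [_ _ _ /(_ c) /loewner_geN hS] := cert.
have := hS (slack_sym A (Cw w) c (yhat w)) v.
rewrite v1 expr1n mulr1 => h.
by have := le_lt_trans h hv; rewrite ltrN2 ltNge tde.
Qed.
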